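(* Fix $\varepsilon>0$. Let $\Gamma\in C_b^1(\mathbb{R})$ be $2\pi$-periodic, let $H\in C_b^2(\mathbb{R}^2)$ be $2\pi$-periodic in each argument, and let $\omega,\theta_0\in L^\infty([0,1])$. Suppose that for each $N$ there are step functions $\theta_0^N,\omega^N$, constant on each cell $I_i^N$, with $\|\theta_0^N-\theta_0\|_\infty+\|\omega^N-\omega\|_\infty\to0$ as $N\to\infty$. Let $\theta^N$ be the step-field solution induced by the truncated reduced finite-$N$ system with initial datum $\theta_0^N$ and frequency field $\omega^N$, and let $\theta$ be the strong solution of $$\partial_t\theta=\omega+K[\theta]+\varepsilon P[\theta;\omega]+\varepsilon T[\theta],\qquad\theta|_{t=0}=\theta_0.$$ Then for every fixed final time $\tau>0$, $$\sup_{t\in[0,\tau]}\|\theta^N(t)-\theta(t)\|_\infty\to0\qquad(N\to\infty).$$ More precisely, $$\sup_{t\in[0,\tau]}\|\theta^N(t)-\theta(t)\|_\infty\le C_\tau^{\mathrm{red}}\bigl(\|\theta_0^N-\theta_0\|_\infty+\|\omega^N-\omega\|_\infty\bigr),$$ where $C_\tau^{\mathrm{red}}$ is a constant depending only on $\tau$ and on the constants $\Lambda_\varepsilon$, $B_\varepsilon$ of the context, and is independent of $N$.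
   Context: $\|\cdot\|_\infty$ is the essential supremum norm on real-valued $L^\infty([0,1])$; $C_b^k$ denotes $C^k$ functions bounded together with all partial derivatives up to order $k$. Cells: $I_1^N=[0,1/N]$, $I_i^N=((i-1)/N,i/N]$ for $2\le i\le N$. Truncated reduced finite-$N$ system: $$\dot\theta_i^N=\omega_i^N+\frac1N\sum_jH(\theta_i^N,\theta_j^N)\Gamma(\theta_j^N-\theta_i^N)+\frac{\varepsilon}{N}\sum_jP_{ij}^N(\theta^N)+\frac{\varepsilon}{N^2}\sum_{j,k}T_{ijk}^N(\theta^N),$$ $$P_{ij}^N(\theta)=-\Gamma(\theta_j-\theta_i)\bigl(\partial_1H(\theta_i,\theta_j)\omega_i^N+\partial_2H(\theta_i,\theta_j)\omega_j^N\bigr),$$ $$T_{ijk}^N(\theta)=-\Gamma(\theta_j-\theta_i)\partial_1H(\theta_i,\theta_j)H(\theta_i,\theta_k)\Gamma(\theta_k-\theta_i)-\Gamma(\theta_j-\theta_i)\partial_2H(\theta_i,\theta_j)H(\theta_j,\theta_k)\Gamma(\theta_k-\theta_j),$$ where $\omega_i^N$ and $\theta_i^N(0)$ are the values of $\omega^N$ and $\theta_0^N$ on $I_i^N$; the induced step field is $\theta^N(t,x)=\theta_i^N(t)$ for $x\in I_i^N$. Continuum operators: $$K[\theta](x)=\int_0^1H(\theta(x),\theta(y))\Gamma(\theta(y)-\theta(x))\,dy,$$ $$P[\theta;\omega](x)=-\int_0^1\Gamma(\theta(y)-\theta(x))\bigl(\partial_1H(\theta(x),\theta(y))\omega(x)+\partial_2H(\theta(x),\theta(y))\omega(y)\bigr)dy,$$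 $$T[\theta](x)=-\int_0^1\!\!\int_0^1\Gamma(\theta(y)-\theta(x))\partial_1H(\theta(x),\theta(y))H(\theta(x),\theta(z))\Gamma(\theta(z)-\theta(x))\,dz\,dy$$ $$\qquad-\int_0^1\!\!\int_0^1\Gamma(\theta(y)-\theta(x))\partial_2H(\theta(x),\theta(y))H(\theta(y),\theta(z))\Gamma(\theta(z)-\theta(y))\,dz\,dy.$$ A strong solution on $[0,\tau]$ is $\theta\in W^{1,\infty}([0,\tau];L^\infty([0,1]))$ satisfying the initial condition and the equation for a.e. $t$; it exists uniquely for all times. Constants: put $M_\omega:=\max\{\|\omega\|_\infty,\sup_N\|\omega^N\|_\infty\}<\infty$. Let $C_K,C_P^\theta,C_P^\omega,C_T^\theta$ be constants, depending only on $M_\omega$ and the sup norms of $\Gamma,\Gamma',H$ and of the first and second partial derivatives of $H$, such that for all $\theta_1,\theta_2,\omega_1,\omega_2\in L^\infty([0,1])$ with $\|\omega_\ell\|_\infty\le M_\omega$: $\|K[\theta_1]-K[\theta_2]\|_\infty\le C_K\|\theta_1-\theta_2\|_\infty$, $\|P[\theta_1;\omega_1]-P[\theta_2;\omega_2]\|_\infty\le C_P^\theta\|\theta_1-\theta_2\|_\infty+C_P^\omega\|\omega_1-\omega_2\|_\infty$, $\|T[\theta_1]-T[\theta_2]\|_\infty\le C_T^\theta\|\theta_1-\theta_2\|_\infty$ (such constants exist). Set $\Lambda_\varepsilon=C_K+\varepsilon C_P^\theta+\varepsilon C_T^\theta$ and $B_\varepsilon=1+\varepsilon C_P^\omega$.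 *)

(* Defs.v *)
From HB Require Import structures.
From mathcomp Require Import all_boot all_order all_algebra.
From mathcomp Require Import all_classical all_reals all_analysis.

Set Implicit Arguments.
Unset Strict Implicit.
Unset Printing Implicit Defensive.

Import Order.TTheory GRing.Theory Num.Theory.
Import numFieldNormedType.Exports.

Local Open Scope classical_set_scope.
Local Open Scope ring_scope.

(* L^oo([0,1]).  The measure on [0,1] is Lebesgue measure on the line
   restricted to [0,1]; a class in L^oo([0,1]) is represented by a Borel
   function on the line, whose values outside [0,1] are irrelevant.  Equality
   of classes is almost everywhere equality for [mu01]. *)
Definition mu01 (R : realType) : {measure set (measurableTypeR R) -> \bar R} :=
  mrestr (@lebesgue_measure R)
    (measurable_itv `[0%R, 1%R] : measurable (`[0%R, 1%R] : set R)).

Definition Linf (R : realType) := LfunType (mu01 R) (leey 1%E).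

Definition linf_norm (R : realType) (f : R -> R) : \bar R :=
  ('N[mu01 R]_+oo [EFin \o f])%E.

Fixpoint Cb (R : realType) (k : nat) (f : R -> R) : Prop :=
  [/\ continuous f, bounded_fun f &
      if k is k'.+1 then
        (forall x, derivable f x 1) /\ Cb k' (derive1 f)
      else True].

Definition pd1 (R : realType) (H : R -> R -> R) (a b : R) : R :=
  derive1 (fun u : R => H u b) a.

Definition pd2 (R : realType) (H : R -> R -> R) (a b : R) : R :=
  derive1 (fun v : R => H a v) b.

(* All mixed partial derivatives up to order k exist, are jointly continuous,
   and are bounded. *)
Fixpoint Cb2 (R : realType) (k : nat) (H : R -> R -> R) : Prop :=
  [/\ continuous (fun p : R * R => H p.1 p.2),
      bounded_fun (fun p : R * R => H p.1 p.2) &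
      if k is k'.+1 then
        [/\ forall a b, derivable (fun u : R => H u b) a 1,
            forall a b, derivable (fun v : R => H a v) b 1,
            Cb2 k' (pd1 H) & Cb2 k' (pd2 H)]
      else True].

(* Cell number i + 1 of the partition of [0,1] into N cells, for i = 0..N-1;
   only the first cell is closed on the left. *)
Definition cell (R : realType) (N : nat) (i : 'I_N) : set R :=
  [set x | (if i == 0%N :> nat then i%:R / N%:R <= x else i%:R / N%:R < x)
           && (x <= i.+1%:R / N%:R)].

(* The function equal to v i on cell i; it vanishes outside [0,1]. *)
Definition step_field (R : realType) (N : nat) (v : 'I_N -> R) (x : R) : R :=
  \sum_(i < N) v i * \1_(cell i) x.

Section FiniteSystem.
Variables (R : realType) (eps : R) (Gamma : R -> R) (H : R -> R -> R).
Variables (N : nat) (w : 'I_N -> R).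

Definition P_fin (th : 'I_N -> R) (i j : 'I_N) : R :=
  - (Gamma (th j - th i) *
     (pd1 H (th i) (th j) * w i + pd2 H (th i) (th j) * w j)).

Definition T_fin (th : 'I_N -> R) (i j k : 'I_N) : R :=
  - (Gamma (th j - th i) * pd1 H (th i) (th j) *
     H (th i) (th k) * Gamma (th k - th i))
  - Gamma (th j - th i) * pd2 H (th i) (th j) *
    H (th j) (th k) * Gamma (th k - th j).

Definition rhs_fin (th : 'I_N -> R) (i : 'I_N) : R :=
  w i
  + N%:R^-1 * (\sum_(j < N) H (th i) (th j) * Gamma (th j - th i))
  + eps / N%:R * (\sum_(j < N) P_fin th i j)
  + eps / N%:R ^+ 2 * (\sum_(j < N) \sum_(k < N) T_fin th i j k).

(* Solutions on [0,+oo[, with only one-sided regularity required at t = 0. *)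
Definition finite_solution (th0 : 'I_N -> R) (th : R -> 'I_N -> R) : Prop :=
  [/\ forall i, th 0 i = th0 i,
      forall i, {within `[0, +oo[, continuous (fun t : R => th t i)} &
      forall i (t : R), 0 < t ->
        is_derive t 1 (fun s : R => th s i) (rhs_fin (th t) i)].

End FiniteSystem.

Section ContinuumOperators.
Variables (R : realType) (Gamma : R -> R) (H : R -> R -> R).
Let mu := @lebesgue_measure R.
Let I01 : set R := `[0, 1].

Definition K_op (th : R -> R) (x : R) : R :=
  \int[mu]_(y in I01) (H (th x) (th y) * Gamma (th y - th x)).

Definition P_op (th om : R -> R) (x : R) : R :=
  - \int[mu]_(y in I01)
      (Gamma (th y - th x) *
       (pd1 H (th x) (th y) * om x + pd2 H (th x) (th y) * om y)).

Definition T_op (th : R -> R) (x : R) : R :=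
  - (\int[mu]_(y in I01) \int[mu]_(z in I01)
       (Gamma (th y - th x) * pd1 H (th x) (th y) *
        H (th x) (th z) * Gamma (th z - th x)))
  - (\int[mu]_(y in I01) \int[mu]_(z in I01)
       (Gamma (th y - th x) * pd2 H (th x) (th y) *
        H (th y) (th z) * Gamma (th z - th y))).

Definition rhs_cont (eps : R) (om th : R -> R) (x : R) : R :=
  om x + K_op th x + eps * P_op th om x + eps * T_op th x.

End ContinuumOperators.

(* Bochner integration over [0,tau] of curves with values in L^oo([0,1]). *)
Record simple_curve (R : realType) := SimpleCurve {
  pieces : nat;
  piece : 'I_pieces -> set R;
  piece_value : 'I_pieces -> Linf R;
  piece_measurable : forall i, measurable (piece i) }.

Definition simple_eval (R : realType) (s : simple_curve R) (t : R) : Linf R :=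
  \sum_(i < pieces s) \1_(piece i) t *: piece_value i.

Definition simple_integral (R : realType) (tau : R) (s : simple_curve R) :
    Linf R :=
  \sum_(i < pieces s)
    fine (lebesgue_measure (@piece _ s i `&` `[0, tau])) *: piece_value i.

Definition strongly_measurable (R : realType) (tau : R) (g : R -> Linf R) :=
  exists s : nat -> simple_curve R,
    {ae @lebesgue_measure R, forall t : R, t \in `[0, tau] ->
      linf_norm (simple_eval (s n) t \- g t) @[n --> \oo] --> 0%E}.

Definition bochner_integral (R : realType) (tau : R) (g : R -> Linf R)
    (J : Linf R) : Prop :=
  strongly_measurable tau g /\
  exists s : nat -> simple_curve R,
    (\int[@lebesgue_measure R]_(t in `[0%R, tau])
        linf_norm (simple_eval (s n) t \- g t)%R)%E @[n --> \oo] --> 0%E /\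
    linf_norm (simple_integral tau (s n) \- J) @[n --> \oo] --> 0%E.

Definition Linf_curve (R : realType) (tau : R) (g : R -> Linf R) : Prop :=
  strongly_measurable tau g /\
  exists M : R, {ae @lebesgue_measure R, forall t : R, t \in `[0, tau] ->
    (linf_norm (g t) <= M%:E)%E}.

(* C^1 functions with compact support in the open interval ]0,tau[; they define
   the same weak derivatives as the smooth ones. *)
Definition test_function (R : realType) (tau : R) (phi : R -> R) : Prop :=
  [/\ forall t, derivable phi t 1,
      continuous (derive1 phi) &
      exists a b : R, [/\ 0 < a, b < tau &
        forall t, t \notin `[a, b] -> phi t = 0]].

Definition weak_derivative (R : realType) (tau : R) (th g : R -> Linf R) :=
  forall phi, test_function tau phi ->
    exists J : Linf R,
      bochner_integral tau (fun t => derive1 phi t *: th t) J /\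
      bochner_integral tau (fun t => phi t *: g t) (- J).

(* th is in W^{1,oo}([0,tau]; L^oo([0,1])) with weak derivative g.  Such a
   class has exactly one continuous representative, and th is taken to be that
   one, so that its value at every time is meaningful. *)
Definition W1inf (R : realType) (tau : R) (th g : R -> Linf R) : Prop :=
  [/\ forall t : R, t \in `[0, tau] ->
        linf_norm (th s \- th t) @[s --> within `[0, tau] (nbhs t)] --> 0%E,
      Linf_curve tau th, Linf_curve tau g & weak_derivative tau th g].

Definition strong_solution (R : realType) (eps : R) (Gamma : R -> R)
    (H : R -> R -> R) (om th0 : Linf R) (tau : R) (th : R -> Linf R) : Prop :=
  exists g : R -> Linf R,
    [/\ W1inf tau th g,
        {ae mu01 R, forall x : R, th 0 x = th0 x} &
        {ae @lebesgue_measure R, forall t : R, t \in `[0, tau] ->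
          {ae mu01 R, forall x : R,
            g t x = rhs_cont Gamma H eps om (th t) x}}].

Definition M_omega (R : realType) (om : R -> R)
    (w : forall N : nat, 'I_N -> R) : \bar R :=
  maxe (linf_norm om)
    (ereal_sup [set linf_norm (step_field (w N)) | N in [set N | (0 < N)%N]]).

(* Any reals for which the bounds hold are admitted; no sign is imposed. *)
Definition lipschitz_constants (R : realType) (Gamma : R -> R)
    (H : R -> R -> R) (M : \bar R) (CK CPth CPom CT : R) : Prop :=
  forall th1 th2 om1 om2 : Linf R,
    (linf_norm om1 <= M)%E -> (linf_norm om2 <= M)%E ->
    [/\ (linf_norm (K_op Gamma H th1 \- K_op Gamma H th2)%R
           <= CK%:E * linf_norm (th1 \- th2)%R)%E,
        (linf_norm (P_op Gamma H th1 om1 \- P_op Gamma H th2 om2)%R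
           <= CPth%:E * linf_norm (th1 \- th2)%R
              + CPom%:E * linf_norm (om1 \- om2)%R)%E &
        (linf_norm (T_op Gamma H th1 \- T_op Gamma H th2)%R
           <= CT%:E * linf_norm (th1 \- th2)%R)%E].

Definition Lambda (R : realType) (eps CK CPth CT : R) : R :=
  CK + eps * CPth + eps * CT.

Definition Bconst (R : realType) (eps CPom : R) : R := 1 + eps * CPom.

Definition data_error (R : realType) (om th0 : Linf R) (N : nat)
    (w th0N : 'I_N -> R) : \bar R :=
  (linf_norm (step_field th0N \- th0)%R + linf_norm (step_field w \- om)%R)%E.

Definition sup_error (R : realType) (tau : R) (th : R -> Linf R) (N : nat)
    (thN : R -> 'I_N -> R) : \bar R :=
  ereal_sup [set linf_norm (step_field (thN t) \- th t) | t in `[0, tau]].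

(* Main.v *)
Require Import Defs.
From HB Require Import structures.
From mathcomp Require Import all_boot all_order all_algebra.
From mathcomp Require Import all_classical all_reals all_analysis.
From mathcomp Require Import measurable_realfun ess_sup_inf ring lra.

Set Implicit Arguments.
Unset Strict Implicit.
Unset Printing Implicit Defensive.

Import Order.TTheory GRing.Theory Num.Theory.
Import numFieldNormedType.Exports.

Local Open Scope classical_set_scope.
Local Open Scope ring_scope.

(** The step field of the finite system solves the continuum equation exactly,
    with frequency field and initial datum replaced by step functions: on step
    fields the integrals over [0,1] are the averages (1/N) sum_j
    ([rhs_cont_step]).  The theorem is therefore a stability estimate for one
    equation.  If e(t) is the distance between the two solutions and delta the
    distance between the two frequency fields, the Lipschitz bounds say that
    the two velocities differ by at most L e(t) + B delta, so that
    e' <= L e + B delta and a Gronwall argument concludes.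

    The work lies in making sense of e' <= L e + B delta, since the continuum
    solution is differentiable in time only in the weak sense and with values
    in L^oo.  Vector-valued calculus is avoided by testing against the
    integrals f |-> \int_A f over measurable subsets A of [0,1].  They recover
    the norm ([ess_norm_le_int01]) and commute with the Bochner integral
    ([bochner_int01_dist]), so the weak derivative becomes a weak derivative of
    real functions.  A test function that approximates the indicator of [p,q]
    ([plateau]) turns the latter into the mean value inequality
    e(q) <= e(p) + (L sup_[p,q] e + B delta) (q - p)
    ([ess_norm_increment_le]).  Applied at the time where
    e(t) exp(- (L + 1) t) is maximal, this inequality gives
    e(t) <= exp((L + 1) tau) (e(0) + B delta) ([gronwall_increment]); no
    derivative of e is involved.

    The constant is thus exp((|Lambda| + 1) tau) (1 + |B|).  Absolute values are
    taken because the admitted Lipschitz constants carry no sign.  For the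
    qualitative convergence, constants L and B are produced from the regularity
    of Gamma and H ([rhs_cont_lipschitz]): each operator is built from averages
    of bounded Lipschitz kernels. *)

(** * L^oo([0,1]) tested against integrals over sets *)

Section BoundedIntegrals.
Context d (T : measurableType d) (R : realType).
Variable mu : {measure set T -> \bar R}.
Implicit Types (A : set T) (f g : T -> R).

Lemma integrable_ae_bounded A f c : measurable A -> (mu A < +oo)%E ->
  measurable_fun A f -> {ae mu, forall x, A x -> `|f x| <= c} ->
  mu.-integrable A (EFin \o f).
Proof.
move=> mA Afin mf fc; apply/integrableP.
split; first exact/measurable_EFinP.
apply: (@le_lt_trans _ _ (\int[mu]_(x in A) (`|c|)%:E)%E).
  apply: ae_ge0_le_integral => //.
  - by apply: measurableT_comp => //; exact/measurable_EFinP.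
  - apply: filterS fc => x h Ax /=; rewrite lee_fin.
    exact: le_trans (h Ax) (ler_norm _).
by rewrite integral_cst// lte_mul_pinfty// lee_fin.
Qed.

Lemma le_norm_Rintegral_ae A f c : measurable A -> (mu A < +oo)%E -> 0 <= c ->
  measurable_fun A f -> {ae mu, forall x, A x -> `|f x| <= c} ->
  `|\int[mu]_(x in A) f x| <= c * fine (mu A).
Proof.
move=> mA Afin c0 mf fc.
have If := integrable_ae_bounded mA Afin mf fc.
have Af : mu A \is a fin_num by rewrite ge0_fin_numE.
apply: le_trans (le_normr_Rintegral mA If) _.
rewrite -[c]/(fine c%:E) -fineM// -lee_fin !fineK; last 2 first.
- by rewrite fin_numM.
- exact: (integrable_fin_num mA (integrable_abse If)).
rewrite -integral_cst//; apply: ae_ge0_le_integral => //.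
by do 2 apply: measurableT_comp => //.
Qed.

(** Over the set where f - C is positive, its integral is nonpositive; hence
    this set is null. *)
Lemma ae_le_of_Rintegral_le f C : (mu setT < +oo)%E -> measurable_fun setT f ->
  (forall A, measurable A -> mu.-integrable A (EFin \o f)) ->
  (forall A, measurable A -> \int[mu]_(x in A) f x <= C * fine (mu A)) ->
  {ae mu, forall x, f x <= C}.
Proof.
move=> Tfin mf If H; pose A := [set x : T | C < f x].
have mA : measurable A by rewrite -[A]setTI /A -preimage_itvoy; exact: mf.
have Afin : (mu A < +oo)%E.
  by apply: le_lt_trans Tfin; apply: le_measure => //; rewrite inE.
have IC : mu.-integrable A (EFin \o (fun=> C)).
  by apply: (@integrable_ae_bounded _ _ `|C|) => //; exact: aeW.
have IA : mu.-integrable A (EFin \o (fun x => f x - C)).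
  have := integrableB mA (If A mA) IC; apply: eq_integrable => //.
have : (\int[mu]_(x in A) `|((f x - C)%R)%:E|)%E = 0%E.
  have pospart x : A x -> (0 <= (f x - C)%:E)%E.
    by rewrite /A /= lee_fin subr_ge0 => /ltW.
  rewrite (eq_integral (EFin \o (fun x => f x - C))); last first.
    by move=> x /set_mem Ax; rewrite gee0_abs //; exact: pospart.
  apply/eqP; rewrite eq_le; apply/andP; split; last exact: integral_ge0.
  rewrite -[leLHS]fineK; last exact: integrable_fin_num.
  rewrite lee_fin -[leLHS]/(\int[mu]_(x in A) (f x - C)) RintegralB //.
  - by rewrite Rintegral_cst // subr_le0; exact: H.
  - exact: If.
have mm : measurable_fun A (EFin \o (fun x => f x - C)) by case/integrableP: IA.
move/(ae_eq_integral_abs _ mA mm).1.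
apply: filterS => x /= h; rewrite leNgt; apply/negP => Ax.
by move: (h Ax) => [] /eqP; rewrite subr_eq0 => /eqP E; move: Ax; rewrite E ltxx.
Qed.

End BoundedIntegrals.

Section Norm.
Variable R : realType.
Local Notation mu := (@lebesgue_measure R).
Local Notation m01 := (mu01 R).
Local Notation I01 := (`[0%R, 1%R]%classic : set R).
Implicit Types (f g : R -> R).

(** These two instances let the filter lemmas apply to almost everywhere
    statements for [mu01] and for the Lebesgue measure. *)
#[global] Instance mu01_ae_filter : Filter (nbhs (almost_everywhere m01)).
Proof. exact: ae_filter_ringOfSetsType. Qed.

#[global] Instance lebesgue_ae_filter : Filter (nbhs (almost_everywhere mu)).
Proof. exact: ae_filter_ringOfSetsType. Qed.

Lemma mu01E A : m01 A = mu (A `&` I01).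
Proof. by []. Qed.

Lemma mu01T : m01 setT = 1%E.
Proof. by rewrite mu01E setTI lebesgue_measure_itv /= lte_fin ltr01 oppr0 adde0. Qed.

Lemma mu01_gt0 : (0 < m01 setT)%E.
Proof. by rewrite mu01T. Qed.

Lemma mu01_le1 A : measurable A -> (m01 A <= 1)%E.
Proof. by move=> mA; rewrite -mu01T le_measure ?inE. Qed.

Lemma mu01_fin A : measurable A -> m01 A \is a fin_num.
Proof.
move=> mA; rewrite ge0_fin_numE//; apply: le_lt_trans (mu01_le1 mA) _.
by rewrite ltry.
Qed.

Lemma ae_mu01P (P : R -> Prop) :
  {ae m01, forall x, P x} <-> {ae mu, forall x, I01 x -> P x}.
Proof.
split.
  move=> [N [mN N0 PN]]; exists (N `&` I01); split => //.
  - exact: measurableI.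
  - by move=> x /= /not_implyP[Ix nP]; split => //; exact: PN.
move=> [N [mN N0 PN]]; exists (N `|` ~` I01); split => //.
- by apply: measurableU => //; exact: measurableC.
- rewrite mu01E setIUl setICl setU0; apply: subset_measure0 N0 => //.
  exact: measurableI.
- move=> x /= nP; have [Ix|nIx] := pselect (I01 x); last by right.
  by left; apply: PN => /= H; apply: nP; exact: H.
Qed.

Lemma linf_normE f : linf_norm f = ess_sup m01 (abse \o (EFin \o (f : R -> R))).
Proof. by rewrite /linf_norm unlock /= mu01_gt0. Qed.

Lemma linf_norm_ge0 f : (0 <= linf_norm f)%E.
Proof. exact: Lnorm_ge0. Qed.

Lemma linf_normP f (c : R) :
  (linf_norm f <= c%:E)%E <-> {ae m01, forall x, `|f x| <= c}.
Proof.
rewrite linf_normE; split.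
  by move/ess_supP; apply: filterS => x /=; rewrite lee_fin.
by move=> h; apply/ess_supP; apply: filterS h => x /=; rewrite lee_fin.
Qed.

(** The norm as a real number, meaningful when [linf_norm f] is finite; this
    holds for a difference of two elements of L^oo ([LinfB_fin]). *)
Definition ess_norm f : R := fine (linf_norm f).

Lemma ess_norm_ge0 f : 0 <= ess_norm f.
Proof. by rewrite fine_ge0 // linf_norm_ge0. Qed.

Lemma ess_norm_ae f : linf_norm f \is a fin_num ->
  {ae m01, forall x, `|f x| <= ess_norm f}.
Proof. by move=> ff; apply/linf_normP; rewrite fineK. Qed.

Lemma ae_linf_fin f c : {ae m01, forall x, `|f x| <= c} -> linf_norm f \is a fin_num.
Proof.
move=> /linf_normP h; rewrite ge0_fin_numE ?linf_norm_ge0//.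
by apply: le_lt_trans h _; rewrite ltry.
Qed.

Lemma ess_norm_le f c : {ae m01, forall x, `|f x| <= c} -> ess_norm f <= c.
Proof.
move=> h; have ff := ae_linf_fin h; rewrite -lee_fin fineK //.
exact/linf_normP.
Qed.

Lemma Linf_fin (f : Linf R) : linf_norm f \is a fin_num.
Proof.
rewrite ge0_fin_numE ?linf_norm_ge0//; exact: (@Lfunction_finite _ _ _ _ _ _ f).
Qed.

Lemma Linf_measurable (f : Linf R) :
  @measurable_fun _ _ (measurableTypeR R) R setT f.
Proof. by have /sub_Lfun_mfun := LfunP f; rewrite inE. Qed.

Lemma LinfDE (f g : Linf R) x : (f + g) x = f x + g x.
Proof. by []. Qed.
Lemma LinfZE a (f : Linf R) x : (a *: f) x = a * f x.
Proof. by []. Qed.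

Lemma LinfB_fin (f g : Linf R) : linf_norm (f \- g) \is a fin_num.
Proof. exact: (Linf_fin (f - g)). Qed.

Definition Linf_of_bounded f (mf : @measurable_fun _ _ (measurableTypeR R) R setT f) c
  (fc : forall x, `|f x| <= c) : {g : Linf R | forall x, g x = f x}.
Proof.
have Pf : f \in @Lfun _ (measurableTypeR R) R m01 +oo%E.
  apply/andP; split; first by rewrite inE.
  rewrite inE /= /finite_norm.
  have : linf_norm f \is a fin_num.
    by apply: (@ae_linf_fin _ c); exact: aeW.
  by rewrite ge0_fin_numE ?linf_norm_ge0.
by exists (Lfun_Sub (leey 1%E) Pf).
Defined.

Lemma normr_indic_le1 (A : set R) x : `|\1_A x| <= 1 :> R.
Proof. by rewrite indicE; case: (x \in _) => /=; rewrite ?normr1 ?normr0 ?ler01. Qed.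

Lemma mu01_lty A : measurable A -> (m01 A < +oo)%E.
Proof. by move=> mA; rewrite -ge0_fin_numE // mu01_fin. Qed.

Lemma Linf_integrable (f : Linf R) A : measurable A ->
  m01.-integrable A (EFin \o f).
Proof.
move=> mA; apply: (@integrable_ae_bounded _ _ _ _ _ _ (ess_norm f)) => //.
- exact: mu01_lty.
- by apply: measurable_funTS; exact: Linf_measurable.
- by apply: filterS (ess_norm_ae (Linf_fin f)).
Qed.

(** Only the part of A inside [0,1] counts, since [mu01] does not charge the
    rest of the line. *)
Definition int01 A f : R := \int[m01]_(x in A) f x.

Lemma int01D A (f g : Linf R) : measurable A -> int01 A (f + g) = int01 A f + int01 A g.
Proof. by move=> mA; rewrite /int01 -RintegralD //; exact: Linf_integrable. Qed.

Lemma int01Z A a (f : Linf R) : measurable A -> int01 A (a *: f) = a * int01 A f.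
Proof. by move=> mA; rewrite /int01 -RintegralZl //; exact: Linf_integrable. Qed.

Lemma int010 A : int01 A (0 : Linf R) = 0.
Proof. by rewrite /int01 /Rintegral integral0_eq. Qed.

Lemma int01N A (f : Linf R) : measurable A -> int01 A (- f) = - int01 A f.
Proof. by move=> mA; rewrite -scaleN1r int01Z // mulN1r. Qed.

Lemma int01B A (f g : Linf R) : measurable A -> int01 A (f - g) = int01 A f - int01 A g.
Proof. by move=> mA; rewrite int01D // int01N. Qed.

Lemma int01_sum A n (F : 'I_n -> Linf R) : measurable A ->
  int01 A (\sum_(i < n) F i) = \sum_(i < n) int01 A (F i).
Proof.
move=> mA; elim/big_ind2 : _ => //; first exact: int010.
by move=> x1 x2 y1 y2 <- <-; rewrite int01D.
Qed.

Lemma int01_le_ae A (f : Linf R) c : measurable A ->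
  {ae m01, forall x, `|f x| <= c} -> `|int01 A f| <= c * fine (m01 A).
Proof.
move=> mA fc; apply: le_norm_Rintegral_ae => //.
- exact: mu01_lty.
- by apply: le_trans (ess_norm_le fc); exact: ess_norm_ge0.
- by apply: measurable_funTS; exact: Linf_measurable.
- by apply: filterS fc.
Qed.

Lemma int01_le_norm A (f : Linf R) : measurable A -> `|int01 A f| <= ess_norm f.
Proof.
move=> mA; apply: le_trans (int01_le_ae mA (ess_norm_ae (Linf_fin f))) _.
apply: ler_piMr; first exact: ess_norm_ge0.
by rewrite -lee_fin fineK ?mu01_le1// mu01_fin.
Qed.

(** The integrals over sets detect the positive and the negative part of f
    separately, hence its norm. *)
Lemma ess_norm_le_int01 (f : Linf R) C :
  (forall A, measurable A -> `|int01 A f| <= C * fine (m01 A)) -> ess_norm f <= C.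
Proof.
move=> H; apply: ess_norm_le.
have ub (g : Linf R) : (forall A, measurable A -> int01 A g <= C * fine (m01 A)) ->
    {ae m01, forall x, g x <= C}.
  move=> Hg; apply: ae_le_of_Rintegral_le => //.
  - by apply: mu01_lty; exact: measurableT.
  - by move=> A; exact: Linf_integrable.
have h1 : {ae m01, forall x, f x <= C}.
  by apply: ub => A /H; apply: le_trans; exact: ler_norm.
have h2 : {ae m01, forall x, (- f : Linf R) x <= C}.
  apply: ub => A mA; rewrite int01N //; apply: le_trans (H A mA).
  by rewrite -normrN ler_norm.
by apply: filterS2 h1 h2 => x /= fC fNC; rewrite ler_norml fC andbT lerNl.
Qed.

End Norm.

(** * Bochner integrals tested against integrals over sets *)

Section IntegralTools.
Context d (T : measurableType d) (R : realType).
Variable mu : {measure set T -> \bar R}.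
Local Open Scope ereal_scope.

(** The integral of a nonnegative function is a supremum over the simple
    functions below it, whether or not the function is measurable.  This
    matters for functions t |-> ||g t|| where g is a curve in L^oo: modified on
    a null set of times, g remains an admissible curve, and its norm may fail
    to be Borel. *)
Lemma le_integral_nonmeasurable (D : set T) (f g : T -> \bar R) :
  measurable D -> measurable_fun D g ->
  (forall x, D x -> 0 <= g x) -> (forall x, D x -> 0 <= f x) ->
  {ae mu, forall x, D x -> g x <= f x} ->
  \int[mu]_(x in D) g x <= \int[mu]_(x in D) f x.
Proof.
move=> mD mg g0 f0 [N [mN N0 gfN]].
rewrite (ge0_negligible_integral mN mD mg g0 N0).
rewrite !ge0_integralE//; last by move=> x [Dx _]; exact: g0.
apply: ereal_sup_le => _ /= [h hg <-]; exists h => // x.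
apply: le_trans (hg x) _; rewrite /patch.
case: ifPn => [/set_mem[Dx nNx]|_].
  rewrite mem_set //; apply: contrapT => gf; apply: nNx; apply: gfN => /=.
  by move=> /(_ Dx).
by case: ifPn => // /set_mem Dx; exact: f0.
Qed.

Lemma Rintegral_sum (D : set T) n (f : 'I_n -> T -> R) : measurable D ->
  (forall i, mu.-integrable D (EFin \o f i)) ->
  (\int[mu]_(x in D) (\sum_(i < n) f i x) = \sum_(i < n) \int[mu]_(x in D) f i x)%R.
Proof.
move=> mD If; rewrite /Rintegral.
under eq_integral do rewrite -sumEFin.
rewrite (integral_sum mD If) -sum_fine // => i _.
exact: integrable_fin_num (If i).
Qed.

Lemma integrable_sumr (D : set T) n (f : 'I_n -> T -> R) : measurable D ->
  (forall i, mu.-integrable D (EFin \o f i)) ->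
  mu.-integrable D (EFin \o (fun x => \sum_(i < n) f i x)%R).
Proof.
move=> mD If.
apply: (eq_integrable mD (fun x => \sum_(i < n) (f i x)%:E)) => //.
  by move=> x _ /=; rewrite sumEFin.
by apply: (integrable_sum mD) => i _; exact: If.
Qed.

End IntegralTools.

Section Bochner.
Variable R : realType.
Local Notation mu := (@lebesgue_measure R).
Local Notation m01 := (mu01 R).

Lemma itv_lty (a b : R) : (mu `[a, b] < +oo)%E.
Proof. by rewrite lebesgue_measure_itv /=; case: ifP => _; rewrite ltry. Qed.

Lemma int01_simple_eval A (s : simple_curve R) t : measurable A ->
  int01 A (simple_eval s t) =
  \sum_(i < pieces s) \1_(piece i) t * int01 A (piece_value (s:=s) i).
Proof.
by move=> mA; rewrite int01_sum //; apply: eq_bigr => i _; rewrite int01Z.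
Qed.

Lemma integrable_int01_simple A (s : simple_curve R) tau : measurable A ->
  mu.-integrable `[0, tau] (EFin \o (fun t => int01 A (simple_eval s t))).
Proof.
move=> mA.
rewrite (_ : (fun t => _) = (fun t =>
   \sum_(i < pieces s) \1_(piece i) t * int01 A (piece_value (s:=s) i))).
  2: by apply/funext => t; rewrite int01_simple_eval.
apply: integrable_sumr => // i.
apply: (@integrable_ae_bounded _ _ _ _ _ _ `|int01 A (piece_value (s:=s) i)|) => //.
- exact: itv_lty.
- apply: measurable_funM => //; apply: measurable_indic; exact: piece_measurable.
- by apply: aeW => t _; rewrite normrM ler_piMl// normr_indic_le1.
Qed.

Lemma Rintegral_int01_simple A (s : simple_curve R) tau : measurable A ->
  \int[mu]_(t in `[0, tau]) int01 A (simple_eval s t) =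
  int01 A (simple_integral tau s).
Proof.
move=> mA; rewrite int01_sum //.
under eq_Rintegral do rewrite int01_simple_eval //.
have I1 i : mu.-integrable `[0, tau] (EFin \o (\1_(piece (s:=s) i) : R -> R)).
  apply: (@integrable_ae_bounded _ _ _ _ _ _ 1) => //.
  - exact: itv_lty.
  - by apply: measurable_indic; exact: piece_measurable.
  - by apply: aeW => t _; exact: normr_indic_le1.
rewrite Rintegral_sum //; last first.
  move=> i; have := integrableZr _ (int01 A (piece_value (s:=s) i)) (I1 i).
  by apply.
apply: eq_bigr => i _; rewrite RintegralZr // int01Z //; congr (_ * _).
rewrite /Rintegral integral_indic //; exact: piece_measurable.
Qed.

(** On simple curves [int01 A] commutes with integration, and it is bounded by
    the norm, hence it passes to the limit that defines the Bochner integral.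
    The function t |-> int01 A (f t) may fail to be Borel, f being determined
    up to a null set of times; it is therefore compared with a given function c,
    up to an error m.  For m = 0 this computes int01 A J. *)
Lemma bochner_int01_dist A tau f J (c m : R -> R) : measurable A ->
  bochner_integral tau f J ->
  mu.-integrable `[0, tau] (EFin \o c) -> mu.-integrable `[0, tau] (EFin \o m) ->
  {ae mu, forall t, t \in `[0, tau] -> `|int01 A (f t) - c t| <= m t} ->
  `|int01 A J - \int[mu]_(t in `[0, tau]) c t| <= \int[mu]_(t in `[0, tau]) m t.
Proof.
move=> mA [_ [s [s_int s_J]]] Ic Im cm.
set I := (`[0, tau]%classic : set R).
have mI : @measurable _ (measurableTypeR R) I by exact: measurable_itv.
pose F n t := int01 A (simple_eval (s n) t).
have IF n : mu.-integrable I (EFin \o F n) by exact: integrable_int01_simple.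
pose E n := (\int[mu]_(t in I) linf_norm (simple_eval (s n) t \- f t)%R)%E.
pose del n := ess_norm (simple_integral tau (s n) \- J).
(* The scalar error in excess of m is at most the error in norm, and it is
   Borel measurable. *)
pose G n t := Num.max (`|F n t - c t| - m t) 0.
have IFc n : mu.-integrable I (EFin \o (fun t => F n t - c t)).
  by have := integrableB mI (IF n) Ic; apply: eq_integrable.
have IG n : mu.-integrable I (EFin \o G n).
  have I1 : mu.-integrable I (EFin \o (fun t => `|F n t - c t| - m t)).
    by have := integrableB mI (integrable_norm (IFc n)) Im; apply: eq_integrable.
  have := integrable_funepos mI I1; apply: eq_integrable => // t _.
  by rewrite /= funeposE -EFin_max.
have GE n : ((\int[mu]_(t in I) G n t)%:E <= E n)%E.
  rewrite /Rintegral fineK; last exact: (integrable_fin_num mI (IG n)).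
  apply: le_integral_nonmeasurable => //.
  - by case/integrableP: (IG n).
  - by move=> t _; rewrite lee_fin /G le_max lexx orbT.
  - by move=> t _; exact: linf_norm_ge0.
  - apply: filterS cm => t cmt It; rewrite -[leRHS]fineK; last exact: LinfB_fin.
    rewrite lee_fin /G ge_max ess_norm_ge0 andbT lerBlDr.
    rewrite (_ : F n t - c t = int01 A (simple_eval (s n) t - f t) +
                               (int01 A (f t) - c t)); last first.
      by rewrite int01B // /F addrA subrK.
    apply: le_trans (ler_normD _ _) _; rewrite lerD //.
      exact: (int01_le_norm (simple_eval (s n) t - f t)).
    by apply: cmt.
have key n : (`|int01 A J - \int[mu]_(t in I) c t|%:E <=
    (\int[mu]_(t in I) m t)%:E + (E n + (del n)%:E))%E.
  apply: (@le_trans _ _ ((\int[mu]_(t in I) m t)%:E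
      + ((\int[mu]_(t in I) G n t)%:E + (del n)%:E))%E); last first.
    by rewrite leeD2l // leeD2r.
  rewrite -!EFinD lee_fin.
  rewrite (_ : int01 A J - _ = - int01 A (simple_integral tau (s n) - J) +
      \int[mu]_(t in I) (F n t - c t)); last first.
    rewrite RintegralB // Rintegral_int01_simple // int01B //.
    by rewrite opprB addrA subrK.
  have h2 : `|int01 A (simple_integral tau (s n) - J)| <= del n.
    exact: (int01_le_norm (simple_integral tau (s n) - J)).
  have h1 : `|\int[mu]_(t in I) (F n t - c t)| <=
      \int[mu]_(t in I) m t + \int[mu]_(t in I) G n t.
    apply: le_trans (le_normr_Rintegral mI (IFc n)) _.
    rewrite -RintegralD //; apply: le_Rintegral => //.
    - exact: (integrable_norm (IFc n)).
    - by have := integrableD mI Im (IG n); apply: eq_integrable.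
    - by move=> t _; rewrite -lerBlDl /G le_max lexx.
  apply: le_trans (ler_normD _ _) _; rewrite normrN.
  by apply: le_trans (lerD h2 h1) _; rewrite [leLHS]addrC -addrA.
have del0 : (del n)%:E @[n --> \oo] --> 0%E.
  apply: cvg_trans s_J; apply: near_eq_cvg; apply: nearW => n.
  by rewrite fineK //; exact: LinfB_fin.
have lim0 : ((\int[mu]_(t in I) m t)%:E + (E n + (del n)%:E))%E @[n --> \oo] -->
    (\int[mu]_(t in I) m t)%:E.
  rewrite -[X in _ --> X]adde0; apply: cvgeD => //; first exact: cvg_cst.
  by rewrite -[X in _ --> X]adde0; apply: cvgeD.
rewrite -lee_fin; apply: cvge_ge lim0; apply: nearW => n; exact: key.
Qed.
End Bochner.

(** * Plateau test functions *)

Section Bumps.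
Variable R : realType.
Local Notation mu := (@lebesgue_measure R).
Implicit Types (f : R -> R) (k p q s t a tau : R).

(** For functions given by piecewise formulas, as below, this treats the break
    points like the other points. *)
Lemma is_derive_of_quadratic_bound f (x l M : R) :
  (forall y, `|f y - f x - l * (y - x)| <= M * (y - x) ^+ 2) ->
  is_derive x 1 f l.
Proof.
move=> H.
have M0 : 0 <= M.
  have := H (x + 1); rewrite (_ : x + 1 - x = 1); last by ring.
  by rewrite expr1n !mulr1 => h; apply: le_trans h; exact: normr_ge0.
have lim : (fun h : R => h^-1 *: (f (h *: (1 : R) + x) - f x)) @ 0^' --> l.
  apply/cvgrPdist_le => e e0.
  have d0 : 0 < e / (M + 1) by rewrite divr_gt0 // ltr_pwDr.
  near=> h.
  have h0 : h != 0 by near: h; exact: nbhs_dnbhs_neq.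
  have hd : `|h| <= e / (M + 1).
    near: h; apply: (@dnbhs0_le R R _ d0).
  rewrite /GRing.scale /= mulr1.
  have := H (h + x); rewrite addrK => Hh.
  rewrite (_ : l - _ = - (h^-1 * (f (h + x) - f x - l * h))); last by field.
  rewrite normrN normrM normfV ler_pdivrMl ?normr_gt0 //.
  apply: le_trans Hh _; rewrite -real_normK ?num_real // expr2 mulrCA.
  apply: ler_wpM2l => //; apply: le_trans (ler_wpM2l M0 hd) _.
  rewrite mulrCA ger_pMr // ler_pdivrMr ?mul1r ?lerDl // ltr_pwDr //.
apply: DeriveDef.
  by apply/cvg_ex; exists l.
by apply: cvg_lim => //; exact: Rhausdorff.
Unshelve. all: by end_near. Qed.

Definition pospart (x : R) : R := Num.max 0 x.

Lemma continuous_pospart : continuous pospart.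
Proof.
move=> x.
by apply: (@continuous_max _ _ (fun=> 0) id); [exact: cvg_cst|exact: cvg_id].
Qed.

(** The square of the positive part is C^1, with derivative twice the positive
    part. *)
Lemma possq_bound (x y : R) :
  `|pospart y ^+ 2 - pospart x ^+ 2 - 2 * pospart x * (y - x)| <= (y - x) ^+ 2.
Proof.
rewrite /pospart !maxEle ler_norml.
have s1 := sqr_ge0 (y - x); have s2 := sqr_ge0 x; have s3 := sqr_ge0 y.
case: (leP 0 x) => hx; case: (leP 0 y) => hy; rewrite ?expr0n /=.
- apply/andP; split; nra.
- have : 0 <= x * - y by rewrite mulr_ge0 // oppr_ge0 ltW.
  move=> h; apply/andP; split; nra.
- have : 0 <= - x * y by rewrite mulr_ge0 // oppr_ge0 ltW.
  move=> h; apply/andP; split; nra.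
- apply/andP; split; nra.
Qed.

Lemma derivable_LRcontinuous f (a b : R) :
  (forall t, derivable f t 1) -> derivable_oo_LRcontinuous f a b.
Proof.
move=> df; have cf t : f x @[x --> t] --> f t.
  by apply: differentiable_continuous; exact/derivable1_diffP.
split => //; first exact: cvg_at_right_filter (cf a).
exact: cvg_at_left_filter (cf b).
Qed.

(** A C^1 function equal to 0 before 0 and to 1 after 2k: up to the factor
    2 k^2, a second difference of the squared positive part.  Its derivative
    [tent] is the piecewise affine hat of mass 1 on [0, 2k]. *)
Definition ramp (k s : R) : R :=
  (pospart s ^+ 2 - 2 * pospart (s - k) ^+ 2 + pospart (s - 2 * k) ^+ 2) / (2 * k ^+ 2).

Definition tent (k s : R) : R :=
  (pospart s - 2 * pospart (s - k) + pospart (s - 2 * k)) / k ^+ 2.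

Lemma ramp_bound k (x y : R) : 0 < k ->
  `|ramp k y - ramp k x - tent k x * (y - x)| <= (2 / k ^+ 2) * (y - x) ^+ 2.
Proof.
move=> k0.
have k2 : 0 < 2 * k ^+ 2 by rewrite mulr_gt0 // exprn_gt0.
pose D a b := pospart b ^+ 2 - pospart a ^+ 2 - 2 * pospart a * (b - a).
have -> : ramp k y - ramp k x - tent k x * (y - x) =
    (2 * k ^+ 2)^-1 * (D x y - 2 * D (x - k) (y - k) +
                       D (x - 2 * k) (y - 2 * k)).
  by rewrite /ramp /tent /D; field; rewrite gt_eqF.
rewrite normrM gtr0_norm ?invr_gt0 // ler_pdivrMl //.
have -> : 2 * k ^+ 2 * (2 / k ^+ 2 * (y - x) ^+ 2) = 4 * (y - x) ^+ 2.
  by field; rewrite gt_eqF.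
have B a : `|D (x - a) (y - a)| <= (y - x) ^+ 2.
  have := possq_bound (x - a) (y - a).
  by rewrite -/(D _ _) (_ : y - a - (x - a) = y - x) //; ring.
have := B 0; have := B k; have := B (2 * k); rewrite !subr0.
move: (D _ _) (D (x - k) _) (D x y) => d1 d2 d3.
rewrite !ler_norml => /andP[h1 h1'] /andP[h2 h2'] /andP[h3 h3'].
apply/andP; split; lra.
Qed.

Lemma continuous_tent k : continuous (tent k).
Proof.
move=> s; apply: cvgMr_tmp; apply: cvgD; first apply: cvgB.
- exact: continuous_pospart.
- apply: cvgMl_tmp; apply: (@continuous_comp _ _ _ (fun s => s - k) pospart).
    by apply: cvgB; [exact: cvg_id|exact: cvg_cst].
  exact: continuous_pospart.
- apply: (@continuous_comp _ _ _ (fun s => s - 2 * k) pospart).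
    by apply: cvgB; [exact: cvg_id|exact: cvg_cst].
  exact: continuous_pospart.
Qed.

Lemma tent_ge0 k s : 0 < k -> 0 <= tent k s.
Proof.
move=> k0; rewrite /tent divr_ge0 ?sqr_ge0 // /pospart !maxEle.
by case: (leP 0 s) => h1; case: (leP 0 (s - k)) => h2;
   case: (leP 0 (s - 2 * k)) => h3; lra.
Qed.

Lemma tent_out k s : 0 < k -> (s <= 0) || (2 * k <= s) -> tent k s = 0.
Proof.
move=> k0 hs; apply/eqP; rewrite /tent mulf_eq0; apply/orP; left; apply/eqP.
rewrite /pospart !maxEle.
by case: (leP 0 s) => h1; case: (leP 0 (s - k)) => h2;
   case: (leP 0 (s - 2 * k)) => h3; case/orP: hs => hs; lra.
Qed.

Lemma ramp_0 k s : 0 < k -> s <= 0 -> ramp k s = 0.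
Proof.
move=> k0 hs; rewrite /ramp /pospart !maxEle.
rewrite (_ : (if 0 <= s then s else 0) = 0); last by case: ifP => // ?; lra.
case: ifP => [?|_]; first by lra.
case: ifP => [?|_]; first by lra.
by rewrite expr0n /= mulr0 subr0 addr0 mul0r.
Qed.

Lemma ramp_1 k s : 0 < k -> 2 * k <= s -> ramp k s = 1.
Proof.
move=> k0 hs; rewrite /ramp /pospart !maxEle.
case: ifP => [_|/negP]; last by lra.
case: ifP => [_|/negP]; last by lra.
case: ifP => [_|/negP]; last by lra.
by field; rewrite gt_eqF.
Qed.

Lemma ramp_01 k s : 0 < k -> 0 <= ramp k s <= 1.
Proof.
move=> k0.
have k2 : 0 < 2 * k ^+ 2 by rewrite mulr_gt0 // exprn_gt0.
rewrite /ramp divr_ge0 ?ler_pdivrMr ?(ltW k2) //=.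
  rewrite mul1r /pospart !maxEle.
  by case: (leP 0 s) => h1; case: (leP 0 (s - k)) => h2;
   case: (leP 0 (s - 2 * k)) => h3; nra.
rewrite /pospart !maxEle.
by case: (leP 0 s) => h1; case: (leP 0 (s - k)) => h2;
   case: (leP 0 (s - 2 * k)) => h3; nra.
Qed.

(** A C^1 function with values in [0,1], supported in [p, q] and equal to 1 on
    [p + 2k, q - 2k]; its derivative is a tent just after p minus a tent just
    before q. *)
Definition plateau (k p q t : R) : R := ramp k (t - p) - ramp k (t - (q - 2 * k)).

Lemma is_derive_plateau k p q t : 0 < k ->
  is_derive t 1 (plateau k p q) (tent k (t - p) - tent k (t - (q - 2 * k))).
Proof.
move=> k0; apply: (@is_derive_of_quadratic_bound _ _ _ (4 / k ^+ 2)) => y.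
have := ramp_bound (t - p) (y - p) k0.
have := ramp_bound (t - (q - 2 * k)) (y - (q - 2 * k)) k0.
rewrite (_ : y - p - (t - p) = y - t); last by ring.
rewrite (_ : y - (q - 2 * k) - (t - (q - 2 * k)) = y - t); last by ring.
rewrite /plateau !ler_norml => /andP[h1 h1'] /andP[h2 h2'].
have E : 4 / k ^+ 2 * (y - t) ^+ 2 = 2 * (2 / k ^+ 2 * (y - t) ^+ 2) by ring.
rewrite E; apply/andP; split; nra.
Qed.

Lemma plateau_01 k p q t : 0 < k -> p + 4 * k <= q -> 0 <= plateau k p q t <= 1.
Proof.
move=> k0 pq; rewrite /plateau.
have := ramp_01 (t - p) k0; have := ramp_01 (t - (q - 2 * k)) k0.
have [tl|tr] := leP t (q - 2 * k).
  by rewrite (@ramp_0 _ (t - (q - 2 * k))) ?subr_le0 // subr0.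
rewrite (@ramp_1 _ (t - p)) //; first by lra.
lra.
Qed.

Lemma plateau_out k p q t : 0 < k -> p + 4 * k <= q -> t \notin `[p, q] ->
  plateau k p q t = 0.
Proof.
move=> k0 pq; rewrite in_itv /= negb_and -!ltNge => /orP[tp|qt]; rewrite /plateau.
  by rewrite !ramp_0 ?subr0 //; lra.
by rewrite !ramp_1 ?subrr //; lra.
Qed.

Lemma derive1_plateau k p q : 0 < k ->
  derive1 (plateau k p q) = (fun t => tent k (t - p) - tent k (t - (q - 2 * k))).
Proof.
move=> k0; apply/funext => t.
by rewrite derive1E; have [_ ->] := is_derive_plateau p q t k0.
Qed.

Lemma continuous_tent_shift k a : continuous (fun t => tent k (t - a)).
Proof.
move=> t; apply: (@continuous_comp _ _ _ (fun s => s - a) (tent k)).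
  by apply: cvgB; [exact: cvg_id|exact: cvg_cst].
exact: continuous_tent.
Qed.

Lemma plateau_test_function tau k p q : 0 < k -> p + 4 * k <= q -> 0 < p -> q < tau ->
  test_function tau (plateau k p q).
Proof.
move=> k0 pq p0 qt; split.
- by move=> t; have [] := is_derive_plateau p q t k0.
- rewrite derive1_plateau // => t; apply: cvgB; exact: continuous_tent_shift.
- by exists p, q; split => // t; exact: plateau_out.
Qed.

Lemma Rintegral_tent k p q a : 0 < k -> p < q -> p <= a -> a + 2 * k <= q ->
  \int[mu]_(t in `[p, q]) tent k (t - a) = 1.
Proof.
move=> k0 pq pa aq.
have D t : is_derive t 1 (fun t => ramp k (t - a)) (tent k (t - a)).
  apply: (@is_derive_of_quadratic_bound _ _ _ (2 / k ^+ 2)) => y.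
  have := ramp_bound (t - a) (y - a) k0.
  by rewrite (_ : y - a - (t - a) = y - t) //; ring.
rewrite /Rintegral (@continuous_FTC2 _ _ (fun t => ramp k (t - a))) //=.
- by rewrite ramp_1 ?ramp_0 ?subr0 //; lra.
- apply: continuous_subspaceT; exact: continuous_tent_shift.
- apply: derivable_LRcontinuous => t; by have [] := D t.
- by move=> t _; rewrite derive1E; have [_ ->] := D t.
Qed.

Lemma integrable_within_itv p q f : {within `[p, q], continuous f} ->
  mu.-integrable `[p, q] (EFin \o f).
Proof.
move=> cf; apply: continuous_compact_integrable => //; exact: segment_compact.
Qed.

Lemma within_mul p q f g : {within `[p, q], continuous f} ->
  {within `[p, q], continuous g} -> {within `[p, q], continuous (fun t => f t * g t)}.
Proof. by move=> cf cg t; apply: cvgM; [exact: cf|exact: cg]. Qed.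

Lemma within_tent k p q a : {within `[p, q], continuous (fun t => tent k (t - a))}.
Proof. by apply: continuous_subspaceT; exact: continuous_tent_shift. Qed.

(** The tent has mass 1, and v is within eta of c on its support. *)
Lemma tent_average k p q a c eta v : 0 < k -> p < q -> p <= a -> a + 2 * k <= q ->
  {within `[p, q], continuous v} -> 0 <= eta ->
  (forall t, a < t < a + 2 * k -> `|v t - c| <= eta) ->
  `|\int[mu]_(t in `[p, q]) (tent k (t - a) * v t) - c| <= eta.
Proof.
move=> k0 pq pa aq cv eta0 vc.
have ct := @within_tent k p q a.
have It := integrable_within_itv ct.
have Itv := integrable_within_itv (within_mul ct cv).
have E1 := Rintegral_tent k0 pq pa aq.
rewrite -[c in X in X <= _]mul1r -E1 -RintegralZr // -RintegralB //; last first.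
  apply: integrable_within_itv; apply: within_mul => //.
  by apply: continuous_subspaceT => ?; exact: cvg_cst.
have Id : mu.-integrable `[p, q]
    (EFin \o (fun t => tent k (t - a) * v t - tent k (t - a) * c)).
  apply: integrable_within_itv => t; apply: cvgB; first exact: (within_mul ct cv).
  by apply: cvgMr_tmp; exact: ct.
apply: le_trans (le_normr_Rintegral _ Id) _ => //.
rewrite -[leRHS]mul1r -E1 -RintegralZr //.
apply: le_Rintegral => //.
- exact: integrable_norm.
- apply: integrable_within_itv => t; by apply: cvgMr_tmp; exact: ct.
- move=> t _; rewrite -mulrBr normrM ger0_norm ?tent_ge0 //.
  have [/andP[h1 h2]|] := boolP (a < t < a + 2 * k).
    by rewrite ler_wpM2l ?tent_ge0 // vc // h1.
  rewrite negb_and -!leNgt => h.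
  rewrite tent_out ?mul0r //; case/orP: h => h; apply/orP; [left|right]; lra.
Qed.

(** The derivative of a plateau is the difference of two approximate Dirac
    masses, at p and at q; its integral against v tends to v p - v q as k tends
    to 0. *)
Lemma increment_le_of_plateaus v p q C : p < q -> {within `[p, q], continuous v} ->
  (forall k, 0 < k -> p + 4 * k <= q ->
    `|\int[mu]_(t in `[p, q]) (derive1 (plateau k p q) t * v t)| <= C) ->
  `|v q - v p| <= C.
Proof.
move=> pq cv H; apply/ler_addgt0Pr => eta eta0.
have [_ vp vq] := (continuous_within_itvP v pq).1 cv.
have e2 : 0 < eta / 2 by rewrite divr_gt0.
have [d1 /= d10 D1] : exists2 d : R, 0 < d &
    forall t, p < t < p + d -> `|v t - v p| <= eta / 2.
  move/cvgrPdist_le: vp => /(_ _ e2) [d /= d0 Hd]; exists d => // t /andP[pt td].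
  by rewrite distrC; apply: Hd => //=; rewrite ltr_norml; apply/andP; split; lra.
have [d2 /= d20 D2] : exists2 d : R, 0 < d &
    forall t, q - d < t < q -> `|v t - v q| <= eta / 2.
  move/cvgrPdist_le: vq => /(_ _ e2) [d /= d0 Hd]; exists d => // t /andP[pt td].
  by rewrite distrC; apply: Hd => //=; rewrite ltr_norml; apply/andP; split; lra.
pose k := Num.min ((q - p) / 4) (Num.min (d1 / 2) (d2 / 2)).
have k0 : 0 < k by rewrite !lt_min !divr_gt0 // subr_gt0.
have : k <= (q - p) / 4 by rewrite ge_min lexx.
have : k <= d1 / 2 by rewrite !ge_min lexx orbT.
have : k <= d2 / 2 by rewrite !ge_min lexx !orbT.
move=> kd2 kd1 kpq.
have pkq : p + 4 * k <= q by lra.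
have := H k k0 pkq; rewrite derive1_plateau //.
under eq_Rintegral do rewrite mulrBl.
have c1 := within_mul (@within_tent k p q p) cv.
have c2 := within_mul (@within_tent k p q (q - 2 * k)) cv.
rewrite RintegralB //; [|exact: integrable_within_itv..].
have h1 : `|\int[mu]_(x in `[p, q]) (tent k (x - p) * v x) - v p| <= eta / 2.
  by apply: tent_average => //; [lra|exact: ltW|move=> t ht; apply: D1; lra].
have h2 : `|\int[mu]_(x in `[p, q]) (tent k (x - (q - 2 * k)) * v x) - v q| <= eta / 2.
  by apply: tent_average => //; [lra|lra|exact: ltW|move=> t ht; apply: D2; lra].
move: h1 h2; rewrite !ler_norml => /andP[a1 a2] /andP[b1 b2] /andP[c3 c4].
apply/andP; split; lra.
Qed.

End Bumps.

(** * Mean value inequality for weakly differentiable curves *)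

Section WeakDerivative.
Variable R : realType.
Local Notation mu := (@lebesgue_measure R).
Local Notation m01 := (mu01 R).

Lemma Rintegral_support (p q tau : R) (f : R -> R) : 0 <= p -> q <= tau ->
  (forall t, t \notin `[p, q] -> f t = 0) ->
  \int[mu]_(t in `[0, tau]) f t = \int[mu]_(t in `[p, q]) f t.
Proof.
move=> p0 qt f0.
have -> : `[p, q]%classic = `[0, tau]%classic `&` `[p, q]%classic :> set R.
  rewrite setIidr // => t /=; rewrite !in_itv /= => /andP[pt tq].
  by apply/andP; split; lra.
rewrite Rintegral_mkcondr; congr Rintegral; apply/funext => t.
rewrite patchE; case: ifPn => // tpq; apply: f0.
by apply: contra tpq => ?; rewrite inE.
Qed.

Lemma integrable_support (p q tau : R) (f : R -> R) : 0 <= p -> q <= tau ->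
  (forall t, t \notin `[p, q] -> f t = 0) ->
  mu.-integrable `[p, q] (EFin \o f) -> mu.-integrable `[0, tau] (EFin \o f).
Proof.
move=> p0 qt f0 If.
have E : (EFin \o f) = (EFin \o f) \_ `[p, q].
  apply/funext => t; rewrite patchE; case: ifPn => // tpq /=.
  by rewrite f0 //; apply: contra tpq => ?; rewrite inE.
rewrite E; apply/integrable_restrict => //; rewrite setIidr //.
move=> t /=; rewrite !in_itv /= => /andP[pt tq].
by apply/andP; split; lra.
Qed.

Lemma int01_within_continuous A (tau : R) (th : R -> Linf R) : measurable A ->
  (forall t : R, t \in `[0, tau] ->
    linf_norm (th s \- th t) @[s --> within `[0, tau] (nbhs t)] --> 0%E) ->
  {within `[0, tau], continuous (fun t => int01 A (th t))}.
Proof.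
move=> mA H; apply/subspace_continuousP => t It.
have /fine_cvg {}H := H t It.
apply/cvgrPdist_le => e e0.
move/cvgr0Pnorm_le: H => /(_ e e0); apply: filterS => s /= h.
rewrite distrC -int01B //; apply: le_trans (int01_le_norm _ mA) _.
exact: le_trans (ler_norm _) h.
Qed.

(** Test the weak derivative with a plateau phi.  The integral of phi' times
    int01 A (th t) is minus that of phi times int01 A (g t), and integration by
    parts says the same of u and du.  Hence the integral of phi' against
    u - int01 A th is at most C times the integral of phi, that is, at most
    C (q - p). *)
Lemma int01_increment_le A (tau p q C : R) (th g : R -> Linf R) (u du : R -> R) :
  measurable A -> 0 < p -> p < q -> q < tau -> 0 <= C ->
  W1inf tau th g ->
  (forall t : R, 0 < t -> is_derive t 1 u (du t)) ->
  {within `[p, q], continuous du} ->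
  {ae mu, forall t, t \in `[p, q] -> `|du t - int01 A (g t)| <= C} ->
  `|(u q - int01 A (th q)) - (u p - int01 A (th p))| <= C * (q - p).
Proof.
move=> mA p0 pq qt C0 [th_cont _ _ weak] u_der du_cont duC.
pose w t := int01 A (th t).
have wc : {within `[p, q], continuous w}.
  apply: continuous_subspaceW (int01_within_continuous mA th_cont).
  by move=> t /=; rewrite !in_itv /= => /andP[pt tq]; apply/andP; split; lra.
have uc : {within `[p, q], continuous u}.
  apply: derivable_within_continuous => t; rewrite in_itv /= => /andP[pt _].
  by have [] := u_der t (lt_le_trans p0 pt).
have vc : {within `[p, q], continuous (fun t => u t - w t)}.
  by move=> t; apply: cvgB; [exact: uc|exact: wc].
apply: (@increment_le_of_plateaus _ (fun t => u t - w t) p q) => // k k0 kpq.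
pose phi := plateau k p q; pose dphi : R -> R := derive1 phi.
have p01 t : 0 <= phi t <= 1 by exact: plateau_01.
have phi_out t : t \notin `[p, q] -> phi t = 0 by exact: plateau_out.
have phi_der (t : R) : is_derive t 1 phi (dphi t).
  rewrite /dphi derive1_plateau //; exact: is_derive_plateau.
have dphi_c : continuous dphi.
  by rewrite /dphi derive1_plateau // => t; apply: cvgB; exact: continuous_tent_shift.
have phi_c : continuous phi.
  move=> t; apply: differentiable_continuous; apply/derivable1_diffP.
  by have [] := phi_der t.
have dphi_out t : t \notin `[p, q] -> dphi t = 0.
  rewrite in_itv /= negb_and -!ltNge /dphi derive1_plateau // => h.
  by rewrite !tent_out ?subr0 //; case/orP: h => h; apply/orP; by [left; lra|right; lra].
have [|J [BJ BJ']] := weak phi; first exact: plateau_test_function.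
have wI (f : R -> R) : continuous f -> {within `[p, q], continuous f}.
  exact: continuous_subspaceT.
have qp_out f : (forall t, t \notin `[p, q] -> f t = 0 :> R) ->
    forall h : R -> R, forall t, t \notin `[p, q] -> f t * h t = 0.
  by move=> f0 h t ht; rewrite f0 // mul0r.
have Jw : int01 A J = \int[mu]_(t in `[p, q]) (dphi t * w t).
  have := @bochner_int01_dist _ A tau _ J (fun t => dphi t * w t) (fun=> 0) mA BJ.
  rewrite (Rintegral_support (ltW p0) (ltW qt) (qp_out _ dphi_out w)).
  rewrite Rintegral_cst // mul0r => H.
  apply/eqP; rewrite -subr_eq0 -normr_le0; apply: H.
  - apply: (integrable_support (ltW p0) (ltW qt) (qp_out _ dphi_out w)).
    apply: integrable_within_itv; exact: within_mul (wI _ dphi_c) wc.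
  - exact: (integrable0 mu).
  - by apply: aeW => t _; rewrite int01Z // subrr normr0.
have Jdu : `|- int01 A J - \int[mu]_(t in `[p, q]) (phi t * du t)| <= C * (q - p).
  have := @bochner_int01_dist _ A tau _ (- J) (fun t => phi t * du t)
    (fun t => phi t * C) mA BJ'.
  rewrite (Rintegral_support (ltW p0) (ltW qt) (qp_out _ phi_out du)).
  rewrite (Rintegral_support (ltW p0) (ltW qt) (qp_out _ phi_out (fun=> C))).
  rewrite int01N // => H; apply: le_trans (H _ _ _) _.
  - apply: (integrable_support (ltW p0) (ltW qt) (qp_out _ phi_out du)).
    apply: integrable_within_itv; exact: within_mul (wI _ phi_c) du_cont.
  - apply: (integrable_support (ltW p0) (ltW qt) (qp_out _ phi_out (fun=> C))).
    apply: integrable_within_itv; apply: within_mul (wI _ phi_c) _.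
    by apply: wI => t; exact: cvg_cst.
  - apply: filterS duC => t duCt _.
    have [/duCt h|/phi_out ->] := boolP (t \in `[p, q]); last first.
      by rewrite scale0r int010 !mul0r subrr normr0.
    have /andP[phi0 _] := p01 t.
    rewrite int01Z // -mulrBr normrM (ger0_norm phi0); apply: ler_wpM2l => //.
    by rewrite distrC.
  - rewrite (_ : q - p = fine (mu `[p, q])); last first.
      by rewrite lebesgue_measure_itv /= lte_fin pq.
    rewrite -Rintegral_cst //; apply: le_Rintegral => //.
    + apply: integrable_within_itv; apply: within_mul (wI _ phi_c) _.
      by apply: wI => t; exact: cvg_cst.
    + by apply: integrable_within_itv; apply: wI => t; exact: cvg_cst.
    + by move=> t _; rewrite ler_piMl //; case/andP: (p01 t).
have phi_p : phi p = 0.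
  by rewrite /phi /plateau !ramp_0 ?subrr //; lra.
have phi_q : phi q = 0.
  by rewrite /phi /plateau !ramp_1 ?subrr //; lra.
have parts : \int[mu]_(t in `[p, q]) (phi t * du t) =
    - \int[mu]_(t in `[p, q]) (dphi t * u t).
  rewrite (@Rintegration_by_parts _ phi u dphi du) //.
  - by rewrite phi_p phi_q !mul0r subr0 sub0r.
  - exact: wI.
  - by apply: derivable_LRcontinuous => t; have [] := phi_der t.
  - have /(continuous_within_itvP _ pq)[_ up uq] := uc.
    split => // t; rewrite in_itv /= => /andP[pt _].
    by have [] := u_der t (lt_trans p0 pt).
  - move=> t; rewrite in_itv /= => /andP[pt _]; rewrite derive1E.
    by have [_ ->] := u_der t (lt_trans p0 pt).
under eq_Rintegral do rewrite mulrBr.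
rewrite RintegralB //.
- by move: Jdu; rewrite parts -Jw opprK addrC.
- apply: integrable_within_itv; exact: within_mul (wI _ dphi_c) uc.
- apply: integrable_within_itv; exact: within_mul (wI _ dphi_c) wc.
Qed.

(** For each set A the increment of int01 A (y - th) is bounded by
    C (q - p) times the measure of A; being proportional to this measure, the
    bound passes to the norm.  Differentiability of y is required only after
    testing, which for step fields means that of the components. *)
Lemma ess_norm_increment_le (tau p q C : R) (th g y dy : R -> Linf R) :
  0 < p -> p < q -> q < tau -> 0 <= C -> W1inf tau th g ->
  (forall A (t : R), measurable A -> 0 < t ->
    is_derive t 1 (fun s => int01 A (y s)) (int01 A (dy t))) ->
  (forall A, measurable A -> {within `[p, q], continuous (fun t => int01 A (dy t))}) ->
  {ae mu, forall t, t \in `[p, q] -> ess_norm (dy t \- g t) <= C} ->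
  ess_norm (y q \- th q) <= ess_norm (y p \- th p) + C * (q - p).
Proof.
move=> p0 pq qt C0 W yder dyc dyC; apply: (@ess_norm_le_int01 _ (y q - th q)) => A mA.
have mA0 : 0 <= fine (m01 A) by exact: fine_ge0.
have := @int01_increment_le A tau p q (C * fine (m01 A)) th g
  (fun t => int01 A (y t)) (fun t => int01 A (dy t)) mA p0 pq qt
  (mulr_ge0 C0 mA0) W (fun t => yder A t mA) (dyc A mA).
have H : {ae mu, forall t, t \in `[p, q] ->
    `|int01 A (dy t) - int01 A (g t)| <= C * fine (m01 A)}.
  apply: filterS dyC => t h /h {}h; rewrite -int01B //; apply: int01_le_ae => //.
  have := ess_norm_ae (LinfB_fin (dy t) (g t)); apply: filterS => x hx.
  exact: le_trans hx h.
move=> /(_ H); rewrite -int01B // -int01B // => {}H.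
have Hp : `|int01 A (y p - th p)| <= ess_norm (y p \- th p) * fine (m01 A).
  apply: int01_le_ae => //; exact: (ess_norm_ae (LinfB_fin (y p) (th p))).
rewrite -(subrK (int01 A (y p - th p)) (int01 A (y q - th q))).
apply: le_trans (ler_normD _ _) _; rewrite mulrDl addrC.
by apply: lerD => //; rewrite mulrAC; exact: H.
Qed.

End WeakDerivative.

(** * A Gronwall inequality for increments *)

Section Gronwall.
Variable R : realType.

(** Let c be a point of [0, tau] where e(t) exp(- (L + 1) t) is maximal.  If
    c = 0, the maximum is e(0).  If c > 0, maximality forces e to grow on
    [c - s, c] by about (L + 1) e(c) s, whereas the increment is at most
    (L e(c) + D) s; as s tends to 0 this gives e(c) <= D. *)
Lemma gronwall_increment (e : R -> R) (tau L D : R) :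
  0 < tau -> 0 <= L -> 0 <= D ->
  {within `[0, tau], continuous e} -> (forall t, 0 <= e t) ->
  (forall p q E, 0 < p -> p < q -> q <= tau -> 0 <= E ->
     (forall t, p <= t <= q -> e t <= E) -> e q <= e p + (L * E + D) * (q - p)) ->
  forall t, 0 <= t <= tau -> e t <= expR ((L + 1) * tau) * (e 0 + D).
Proof.
move=> tau0 L0 D0 ec e0 inc.
pose lam := L + 1; have lam0 : 0 < lam by rewrite ltr_pwDr.
pose m t := e t * expR (- (lam * t)).
have mc : {within `[0, tau], continuous m}.
  move=> t; apply: cvgM; first exact: ec.
  apply: (@continuous_subspaceT _ _ _ (fun t => expR (- (lam * t)))) => s.
  apply: (@continuous_comp _ _ _ (fun s => - (lam * s)) expR).
    by apply: cvgN; apply: cvgMl_tmp; exact: cvg_id.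
  exact: continuous_expR.
have em t : e t = m t * expR (lam * t).
  by rewrite /m -mulrA -expRD addNr expR0 mulr1.
have [c /itvP cI mmax] := EVT_max (ltW tau0) mc.
have mcle : m c <= e 0 + D.
  have [c0|c0] := leP c 0.
    have -> : c = 0 by apply/eqP; rewrite eq_le c0 cI.
    by rewrite /m mulr0 oppr0 expR0 mulr1 lerDl.
  suff ecD : e c <= D.
    apply: le_trans (_ : e c <= _).
      by rewrite /m ler_piMr // -[leRHS]expR0 ler_expR oppr_le0 mulr_ge0 ?cI // ltW.
    by apply: le_trans ecD _; rewrite lerDr.
  have key s : 0 < s -> s < c -> lam * e c <= (L * e c + D) * (1 + lam * s).
    move=> s0 sc.
    have ls : 0 < 1 + lam * s by rewrite ltr_pwDl // mulr_ge0 // ltW.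
    have bound t : 0 <= t <= c -> e t <= e c * expR (lam * (t - c)).
      move=> /andP[t0 tc]; rewrite [leLHS]em mulrBr expRD mulrCA -/(m c) mulrC.
      by rewrite ler_wpM2l ?expR_ge0 // mmax // in_itv /= t0 (le_trans tc) // cI.
    have := inc (c - s) c (e c); rewrite opprB addrCA subrr addr0.
    move=> /(_ _ _ _ (e0 c) _) inc1.
    have {inc1} : e c <= e (c - s) + (L * e c + D) * s.
      apply: inc1; [lra|lra|by rewrite cI|move=> t /andP[ht tc]].
      apply: le_trans (bound t _) _; first by apply/andP; split; lra.
      rewrite ler_piMr // -[leRHS]expR0 ler_expR mulr_ge0_le0 ?subr_le0 //.
      exact: ltW.
    (* This is where maximality at c enters, with exp(-x) <= 1 / (1 + x). *)
    have : e (c - s) <= e c / (1 + lam * s).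
      apply: le_trans (bound _ _) _; first by apply/andP; split; lra.
      rewrite ler_wpM2l // addrAC subrr add0r mulrN expRN.
      by rewrite lef_pV2 ?posrE ?expR_gt0 // expR_ge1Dx.
    move=> h1 h2; have h : e c - e c / (1 + lam * s) <= (L * e c + D) * s by lra.
    rewrite -(ler_pM2r s0).
    have -> : lam * e c * s = (e c - e c / (1 + lam * s)) * (1 + lam * s).
      by field; rewrite gt_eqF.
    by rewrite mulrAC ler_wpM2r // ltW.
  have X0 : 0 <= L * e c + D by rewrite addr_ge0 // mulr_ge0.
  have : lam * e c <= L * e c + D.
    apply/ler_addgt0Pr => eta eta0.
    have Y0 : 0 < lam * (L * e c + D) + 1 by rewrite ltr_wpDl // mulr_ge0 // ltW.
    pose s := Num.min (c / 2) (eta / (lam * (L * e c + D) + 1)).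
    have s0 : 0 < s by rewrite lt_min !divr_gt0.
    have sc : s < c by rewrite gt_min; apply/orP; left; lra.
    apply: le_trans (key s s0 sc) _.
    have : s <= eta / (lam * (L * e c + D) + 1) by rewrite ge_min lexx orbT.
    rewrite ler_pdivlMr // => hs; nra.
  by rewrite /lam; lra.
move=> t /andP[t0 tt]; rewrite em mulrC.
apply: ler_pM => //.
- by rewrite /m mulr_ge0 // expR_ge0.
- by rewrite ler_expR ler_wpM2l // ltW.
- by apply: le_trans mcle; apply: mmax; rewrite in_itv /= t0.
Qed.

End Gronwall.

(** * Step fields *)

Section StepFields.
Variables (R : realType) (N : nat).
Hypothesis N0 : (0 < N)%N.
Local Notation mu := (@lebesgue_measure R).
Local Notation I01 := (`[0%R, 1%R]%classic : set R).
Implicit Types (v : 'I_N -> R) (i j : 'I_N).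

Let N0r : 0 < N%:R :> R. Proof. by rewrite ltr0n. Qed.

Lemma cellE i : cell (R := R) i =
  (if i == 0%N :> nat then `[i%:R / N%:R, i.+1%:R / N%:R]%classic
   else `]i%:R / N%:R, i.+1%:R / N%:R]%classic).
Proof. by apply/seteqP; split => x; rewrite /cell; case: ifP => _ /=; rewrite in_itv. Qed.

Lemma measurable_cell i : @measurable _ (measurableTypeR R) (cell i).
Proof. by rewrite cellE; case: ifP => _; exact: measurable_itv. Qed.

Lemma lebesgue_measure_cell i : mu (cell i) = (N%:R^-1)%:E.
Proof.
have lt : i%:R / N%:R < i.+1%:R / N%:R :> R by rewrite ltr_pM2r ?invr_gt0 // ltr_nat.
have E : i.+1%:R / N%:R - i%:R / N%:R = N%:R^-1 :> R.
  by rewrite -mulrBl -natrB // subSnn mul1r.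
by rewrite cellE; case: ifP => _; rewrite lebesgue_measure_itv /= lte_fin lt -EFinD E.
Qed.

Lemma cell_sub01 i : cell i `<=` I01.
Proof.
move=> x; rewrite /cell /= in_itv /= => /andP[h1 h2]; apply/andP; split.
  have i0 : 0 <= i%:R / N%:R :> R by rewrite divr_ge0 ?ler0n.
  by move: h1; case: ifP => _; [exact: le_trans|move=> /ltW; exact: le_trans].
by apply: le_trans h2 _; rewrite ler_pdivrMr // mul1r ler_nat.
Qed.

Lemma cell_cover (x : R) : I01 x -> exists i, cell i x.
Proof.
rewrite /= in_itv /= => /andP[x0 x1].
have ex : exists n : nat, x <= n.+1%:R / N%:R.
  by exists N.-1; rewrite prednK // divff // gt_eqF.
have nN : (ex_minn ex < N)%N.
  case: ex_minnP => n _ /(_ N.-1); rewrite prednK // divff ?gt_eqF // => /(_ x1).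
  by rewrite -ltnS prednK.
(* The cell is given by the least n with x <= (n + 1) / N. *)
exists (Ordinal nN); rewrite /cell /=; case: ex_minnP => n xn nmin.
rewrite xn andbT; case: ifPn => [/eqP ->|n0]; first by rewrite mul0r.
rewrite ltNge; apply/negP => xn'; have := nmin n.-1.
rewrite prednK ?lt0n // => /(_ xn'); rewrite leqNgt => /negP; apply.
by rewrite ltn_predL lt0n.
Qed.

Lemma cell_inj i j (x : R) : cell i x -> cell j x -> i = j.
Proof.
wlog : i j / (i <= j)%N.
  move=> W ci cj; case: (leqP i j) => [ij|/ltnW ji]; first exact: W.
  by apply/esym; apply: W.
move=> ij; rewrite /cell /= => /andP[_ xi] /andP[xj _].
apply/eqP; rewrite -val_eqE /= eqn_leq ij /= leqNgt; apply/negP => lij.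
move: xj; rewrite ifF; last by rewrite gtn_eqF // (leq_ltn_trans _ lij).
rewrite ltNge => /negP; apply; apply: le_trans xi _.
by rewrite ler_pM2r ?invr_gt0 // ler_nat.
Qed.

Lemma step_field_cell v i (x : R) : cell i x -> step_field v x = v i.
Proof.
move=> ci; rewrite /step_field (bigD1 i) //= indicE mem_set // mulr1 big1 ?addr0 //.
move=> j /negP ji; rewrite indicE memNset ?mulr0 // => cj.
by apply: ji; apply/eqP; exact: cell_inj cj ci.
Qed.

Lemma integral_cellwise (f : R -> R) v : (forall j y, cell j y -> f y = v j) ->
  \int[mu]_(y in I01) f y = N%:R^-1 * \sum_(j < N) v j.
Proof.
move=> fv.
have mI : @measurable _ (measurableTypeR R) I01 by exact: measurable_itv.
have -> : \int[mu]_(y in I01) f y =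
    \int[mu]_(y in I01) (\sum_(j < N) \1_(cell j) y * v j).
  apply: eq_Rintegral => y /set_mem /cell_cover[j cj].
  rewrite (fv j) // -(@step_field_cell v j y cj).
  by rewrite /step_field; apply: eq_bigr => k _; rewrite mulrC.
have I1 j : mu.-integrable I01 (EFin \o (\1_(cell j) : R -> R)).
  apply: (@integrable_ae_bounded _ _ _ _ _ _ 1) => //.
  - exact: itv_lty.
  - by apply: measurable_indic; exact: measurable_cell.
  - by apply: aeW => t _; exact: normr_indic_le1.
rewrite (Rintegral_sum mI); last first.
  by move=> j; have := integrableZr mI (v j) (I1 j); apply.
rewrite mulr_sumr; apply: eq_bigr => j _; rewrite RintegralZr //; congr (_ * _).
rewrite /Rintegral integral_indic //; last exact: measurable_cell.
by rewrite setIidl; [exact: (congr1 fine (lebesgue_measure_cell j))|exact: cell_sub01].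
Qed.

Definition cellL i : Linf R :=
  sval (@Linf_of_bounded R \1_(cell i) (measurable_indic (measurable_cell i)) 1
          (normr_indic_le1 (cell i))).

(** [step_field v] as an element of L^oo, in the form of a linear combination
    to which the linearity of [int01] applies. *)
Definition stepL v : Linf R := \sum_(i < N) v i *: cellL i.

Lemma stepLE v x : stepL v x = step_field v x.
Proof.
rewrite /stepL /step_field.
apply: (big_ind2 (fun (f : Linf R) (a : R) => f x = a)) => // [f a g b fa gb|i _].
  by rewrite LinfDE fa gb.
by rewrite LinfZE /cellL; case: (Linf_of_bounded _ _) => g /= ->.
Qed.

Lemma stepL_fun v : (stepL v : R -> R) = step_field v.
Proof. by apply/funext => x; exact: stepLE. Qed.

Lemma int01_stepL A v : measurable A ->
  int01 A (stepL v) = \sum_(i < N) v i * int01 A (cellL i).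
Proof. by move=> mA; rewrite int01_sum //; apply: eq_bigr => i _; rewrite int01Z. Qed.

Lemma ess_norm_stepL_le v c : 0 <= c -> (forall i, `|v i| <= c) ->
  ess_norm (step_field v) <= c.
Proof.
move=> c0 vc; apply: ess_norm_le; apply/ae_mu01P; apply: aeW => x /cell_cover[i ci].
by rewrite (step_field_cell _ ci).
Qed.

End StepFields.

Section StepRhs.
Variables (R : realType) (N : nat) (N0 : (0 < N)%N).
Local Notation mu := (@lebesgue_measure R).
Local Notation I01 := (`[0%R, 1%R]%classic : set R).
Variables (eps : R) (Gamma : R -> R) (H : R -> R -> R).

(** The integral over [0,1] of a function that is constant on each cell is its
    average over the cells; thus step fields carry the finite system to the
    continuum equation without any consistency error. *)
Lemma rhs_cont_step (w th : 'I_N -> R) i x : cell i x ->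
  rhs_cont Gamma H eps (step_field w) (step_field th) x = rhs_fin eps Gamma H w th i.
Proof.
move=> ci.
have sx := step_field_cell N0 _ ci.
rewrite /rhs_cont /rhs_fin sx; congr (_ + _ + _ + _).
- rewrite /K_op; apply: integral_cellwise => // j y cj.
  by rewrite sx (step_field_cell N0 _ cj).
- rewrite /P_op (integral_cellwise N0 (v := fun j => - P_fin Gamma H w th i j)).
    by rewrite sumrN !mulrN opprK mulrA.
  by move=> j y cj /=; rewrite !sx !(step_field_cell N0 _ cj) /P_fin opprK.
- pose a j k := Gamma (th j - th i) * pd1 H (th i) (th j) *
    H (th i) (th k) * Gamma (th k - th i).
  pose b j k := Gamma (th j - th i) * pd2 H (th i) (th j) *
    H (th j) (th k) * Gamma (th k - th j).
  pose sth := step_field th.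
  have Ea : \int[mu]_(y in I01) \int[mu]_(z in I01) (Gamma (sth y - sth x) *
        pd1 H (sth x) (sth y) * H (sth x) (sth z) * Gamma (sth z - sth x)) =
      N%:R^-1 * \sum_(j < N) (N%:R^-1 * \sum_(k < N) a j k).
    apply: (integral_cellwise N0 (v := fun j => N%:R^-1 * \sum_(k < N) a j k)) => j y cj.
    apply: (integral_cellwise N0 (v := a j)) => k z ck.
    by rewrite /sth sx (step_field_cell N0 _ cj) (step_field_cell N0 _ ck).
  have Eb : \int[mu]_(y in I01) \int[mu]_(z in I01) (Gamma (sth y - sth x) *
        pd2 H (sth x) (sth y) * H (sth y) (sth z) * Gamma (sth z - sth y)) =
      N%:R^-1 * \sum_(j < N) (N%:R^-1 * \sum_(k < N) b j k).
    apply: (integral_cellwise N0 (v := fun j => N%:R^-1 * \sum_(k < N) b j k)) => j y cj.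
    apply: (integral_cellwise N0 (v := b j)) => k z ck.
    by rewrite /sth sx (step_field_cell N0 _ cj) (step_field_cell N0 _ ck).
  rewrite /T_op -/sth Ea Eb.
  have -> : \sum_(j < N) \sum_(k < N) T_fin Gamma H th i j k =
      - (\sum_(j < N) \sum_(k < N) a j k) - \sum_(j < N) \sum_(k < N) b j k.
    rewrite -opprD -big_split -sumrN /=; apply: eq_bigr => j _.
    rewrite -big_split -sumrN /=; apply: eq_bigr => k _.
    by rewrite /a /b /T_fin opprD.
  rewrite -!mulr_sumr; field; by rewrite pnatr_eq0 -lt0n.
Qed.

End StepRhs.

(** * Stability of the finite system against the continuum equation *)

Section NormTriangle.
Variable R : realType.
Local Notation m01 := (mu01 R).

Lemma ess_normB_triangle (f g h : Linf R) :
  ess_norm (f \- h) <= ess_norm (f \- g) + ess_norm (g \- h).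
Proof.
apply: ess_norm_le.
apply: filterS2 (ess_norm_ae (LinfB_fin f g)) (ess_norm_ae (LinfB_fin g h)).
move=> x /= h1 h2; rewrite -(subrK (g x) (f x)) -addrA.
by apply: le_trans (ler_normD _ _) _; apply: lerD.
Qed.

Lemma ess_normBC (f g : Linf R) : ess_norm (f \- g) = ess_norm (g \- f).
Proof.
have le (a b : Linf R) : ess_norm (a \- b) <= ess_norm (b \- a).
  apply: ess_norm_le; apply: filterS (ess_norm_ae (LinfB_fin b a)) => x /=.
  by rewrite distrC.
by apply/eqP; rewrite eq_le !le.
Qed.

Lemma ess_norm_dist_continuous (D : set R) (y z : R -> Linf R) :
  (forall t, D t -> ess_norm (y s \- y t) @[s --> within D (nbhs t)] --> (0 : R)) ->
  (forall t, D t -> ess_norm (z s \- z t) @[s --> within D (nbhs t)] --> (0 : R)) ->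
  {within D, continuous (fun t => ess_norm (y t \- z t))}.
Proof.
move=> Hy Hz; apply/subspace_continuousP => t Dt.
apply/cvgrPdist_le => e e0.
have e2 : 0 < e / 2 by rewrite divr_gt0.
move/cvgr0Pnorm_le: (Hy t Dt) => /(_ _ e2) H1.
move/cvgr0Pnorm_le: (Hz t Dt) => /(_ _ e2) H2.
apply: filterS2 H1 H2 => s h1 h2.
have {}h1 : ess_norm (y s \- y t) <= e / 2 by apply: le_trans h1; exact: ler_norm.
have {}h2 : ess_norm (z s \- z t) <= e / 2 by apply: le_trans h2; exact: ler_norm.
suff : `|ess_norm (y t \- z t) - ess_norm (y s \- z s)| <= e by [].
have t1 := ess_normB_triangle (y t) (y s) (z t).
have t2 := ess_normB_triangle (y s) (z s) (z t).
have t3 := ess_normB_triangle (y s) (y t) (z s).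
have t4 := ess_normB_triangle (y t) (z t) (z s).
rewrite (ess_normBC (y t) (y s)) in t1; rewrite (ess_normBC (z t) (z s)) in t4.
rewrite ler_norml; apply/andP; split; lra.
Qed.

End NormTriangle.

Section FiniteDynamics.
Variables (R : realType) (eps : R) (Gamma : R -> R) (H : R -> R -> R).
Hypothesis Gc : continuous Gamma.
Hypothesis Hc : continuous (fun p : R * R => H p.1 p.2).
Hypothesis H1c : continuous (fun p : R * R => pd1 H p.1 p.2).
Hypothesis H2c : continuous (fun p : R * R => pd2 H p.1 p.2).
Variables (N : nat) (N0 : (0 < N)%N) (w th0N : 'I_N -> R) (thN : R -> 'I_N -> R).
Local Notation mu := (@lebesgue_measure R).
Local Notation m01 := (mu01 R).

Lemma cvg_sumr (T : Type) (F : set_system T) (FF : Filter F) n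
    (f : 'I_n -> T -> R) (a : 'I_n -> R) :
  (forall i, f i x @[x --> F] --> a i) ->
  (\sum_(i < n) f i x) @[x --> F] --> \sum_(i < n) a i.
Proof.
by move=> fa; apply: cvg_big => [|i _]; [exact: add_continuous|exact: fa].
Qed.

Lemma rhs_fin_cvg (t : R) i : (forall j, {for t, continuous (fun s => thN s j)}) ->
  {for t, continuous (fun s => rhs_fin eps Gamma H w (thN s) i)}.
Proof.
move=> thc; rewrite /prop_for /continuous_at /rhs_fin.
have cH (K : R -> R -> R) : continuous (fun p : R * R => K p.1 p.2) ->
    forall j k, K (thN s j) (thN s k) @[s --> t] --> K (thN t j) (thN t k).
  move=> cK j k.
  apply: (@continuous2_cvg _ _ _ _ (nbhs t) _ (fun s => thN s j)
    (fun s => thN s k) K (thN t j) (thN t k)).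
  - exact: (cK (thN t j, thN t k)).
  - exact: thc.
  - exact: thc.
have cG j k : Gamma (thN s j - thN s k) @[s --> t] --> Gamma (thN t j - thN t k).
  apply: (@continuous_cvg _ _ _ _ _ (fun s => thN s j - thN s k)); first exact: Gc.
  by apply: cvgB; exact: thc.
apply: cvgD; [apply: cvgD; [apply: cvgD|]|].
- exact: cvg_cst.
- apply: cvgMl_tmp; apply: cvg_sumr => j; apply: cvgM; [exact: cH|exact: cG].
- apply: cvgMl_tmp; apply: cvg_sumr => j; rewrite /P_fin; apply: cvgN.
  by apply: cvgM; [exact: cG|apply: cvgD; apply: cvgMr_tmp; exact: cH].
- apply: cvgMl_tmp; apply: cvg_sumr => j; apply: cvg_sumr => k; rewrite /T_fin.

  by apply: cvgB; [apply: cvgN|]; (apply: cvgM; [apply: cvgM; [apply: cvgM|]|]);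
    (exact: cG || exact: cH).
Qed.

Hypothesis sol : finite_solution eps Gamma H w th0N thN.

Lemma finite_solution_continuous_at (t : R) j : 0 < t ->
  {for t, continuous (fun s => thN s j)}.
Proof.
move=> t0; have [_ _ /(_ j t t0) [d _]] := sol.
by apply: differentiable_continuous; exact/derivable1_diffP.
Qed.

Lemma is_derive_int01_step A (t : R) : measurable A -> 0 < t ->
  is_derive t 1 (fun s => int01 A (stepL (thN s)))
    (int01 A (stepL (rhs_fin eps Gamma H w (thN t)))).
Proof.
move=> mA t0; rewrite int01_stepL //.
have -> : (fun s => int01 A (stepL (thN s))) =
    \sum_(i < N) (fun s => int01 A (cellL R i) *: thN s i).
  apply/funext => s; rewrite int01_stepL // fct_sumE.
  by apply: eq_bigr => i _; rewrite mulrC.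
have -> : \sum_(i < N) rhs_fin eps Gamma H w (thN t) i * int01 A (cellL R i) =
    \sum_(i < N) int01 A (cellL R i) *: rhs_fin eps Gamma H w (thN t) i.
  by apply: eq_bigr => i _; rewrite mulrC.
apply: is_derive_sum => i; have [_ _ /(_ i t t0) d] := sol.
exact: is_deriveZ.
Qed.

Lemma continuous_int01_rhs A (p q : R) : measurable A -> 0 < p ->
  {within `[p, q], continuous
    (fun t => int01 A (stepL (rhs_fin eps Gamma H w (thN t))))}.
Proof.
move=> mA p0.
have -> : (fun t => int01 A (stepL (rhs_fin eps Gamma H w (thN t)))) =
    (fun t => \sum_(i < N) rhs_fin eps Gamma H w (thN t) i * int01 A (cellL R i)).
  by apply/funext => t; rewrite int01_stepL.
apply/subspace_continuousP => t; rewrite /= in_itv /= => /andP[pt _].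
apply: cvg_within_filter.
apply: cvg_sumr => i; apply: cvgMr_tmp; apply: rhs_fin_cvg => j.
by apply: finite_solution_continuous_at; exact: lt_le_trans pt.
Qed.

Lemma ess_norm_step_cvg0 (tau t : R) : 0 <= t <= tau ->
  ess_norm (stepL (thN s) \- stepL (thN t))
    @[s --> within `[0, tau] (nbhs t)] --> (0 : R).
Proof.
move=> tI; have [_ thc _] := sol.
have c i : (thN s i - thN t i) @[s --> within `[0, tau] (nbhs t)] --> (0 : R).
  rewrite -[X in _ --> X](subrr (thN t i)); apply: cvgB; last exact: cvg_cst.
  have : {within `[0, tau], continuous (fun t : R => thN t i)}.
    apply: continuous_subspaceW (thc i) => s /=.
    by rewrite !in_itv /= => /andP[-> _].
  move=> /subspace_continuousP h; apply: h.
  by rewrite /= in_itv.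
have : (\sum_(i < N) `|thN s i - thN t i|) @[s --> within `[0, tau] (nbhs t)] --> (0 : R).
  rewrite [X in _ --> X](_ : 0 = \sum_(i < N) `|0 : R|); last first.
    by rewrite big1 // => i _; rewrite normr0.
  by apply: cvg_sumr => i; apply: cvg_norm; exact: c.
move/cvgr0Pnorm_le => h; apply/cvgr0Pnorm_le => e e0.
apply: filterS (h e e0) => s /=.
rewrite ger0_norm ?sumr_ge0 // ger0_norm ?ess_norm_ge0 // => se; apply: le_trans se.
have -> : stepL (thN s) \- stepL (thN t) = step_field (fun i => thN s i - thN t i).
  apply/funext => x /=; rewrite !stepLE /step_field -sumrB.
  by apply: eq_bigr => i _; rewrite mulrBl.
apply: ess_norm_stepL_le => //; first by rewrite sumr_ge0.
by move=> i; rewrite (bigD1 i) //= lerDl sumr_ge0.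
Qed.

Variables (om th0 : Linf R) (th : R -> Linf R) (tau L B : R).
Hypothesis tau0 : 0 < tau.
Hypothesis L0 : 0 <= L.
Hypothesis B0 : 0 <= B.
(* One unit of time beyond tau, so that tau is interior to the interval on
   which the weak formulation holds. *)
Hypothesis csol : strong_solution eps Gamma H om th0 (tau + 1) th.
Hypothesis rhs_lip : forall t, 0 <= t <= tau ->
  {ae m01, forall x,
    `|rhs_cont Gamma H eps (step_field w) (step_field (thN t)) x -
      rhs_cont Gamma H eps om (th t) x| <=
    L * ess_norm (step_field (thN t) \- th t) + B * ess_norm (step_field w \- om)}.

(** The step field is differentiable in time and the continuum solution weakly
    so, with velocities that differ by at most L e + D: the mean value
    inequality [ess_norm_increment_le] provides what [gronwall_increment] asks
    for. *)
Lemma stability_estimate (t : R) : 0 <= t <= tau ->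
  ess_norm (step_field (thN t) \- th t) <= expR ((L + 1) * tau) *
    (ess_norm (step_field th0N \- th0) + B * ess_norm (step_field w \- om)).
Proof.
have [g [W init eqn]] := csol.
have [thN0 thNc _] := sol.
pose e t := ess_norm (stepL (thN t) \- th t).
have eE s : ess_norm (step_field (thN s) \- th s) = e s by rewrite /e stepL_fun.
set D := B * _.
have D0 : 0 <= D by rewrite mulr_ge0 // ess_norm_ge0.
have e00 : e 0 <= ess_norm (step_field th0N \- th0).
  rewrite -stepL_fun; apply: ess_norm_le.
  apply: filterS2 init (ess_norm_ae (LinfB_fin (stepL th0N) th0)) => x /= -> h.
  by rewrite (_ : thN 0 = th0N) //; apply/funext.
rewrite eE => tI.
apply: (@le_trans _ _ (expR ((L + 1) * tau) * (e 0 + D))); last first.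
  by rewrite ler_wpM2l ?expR_ge0 // lerD2r.
apply: gronwall_increment tI => //.
- apply: ess_norm_dist_continuous => s; rewrite /= in_itv /= => sI.
    exact: ess_norm_step_cvg0.
  have [thc _ _ _] := W.
  have sI' : s \in `[0, tau + 1].
    by rewrite in_itv /=; case/andP: sI => -> /le_trans ->; rewrite ?lerDl.
  have /fine_cvg := thc s sI'; apply: cvg_trans; apply: cvg_app.
  apply: within_subset => r /=; rewrite !in_itv /= => /andP[-> /le_trans ->] //.
  by rewrite lerDl.
- by move=> s; exact: ess_norm_ge0.
- move=> p q E p0 pq qt E0 eE'.
  apply: (@ess_norm_increment_le _ (tau + 1) p q _ th g (fun s => stepL (thN s))
    (fun s => stepL (rhs_fin eps Gamma H w (thN s)))) => //.
  + by apply: le_lt_trans qt _; rewrite ltrDl.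
  + by rewrite addr_ge0 // mulr_ge0.
  + by move=> A s mA s0; exact: is_derive_int01_step.
  + by move=> A mA; exact: continuous_int01_rhs.
  + apply: filterS eqn => s seqn; rewrite in_itv /= => /andP[ps sq].
    have sI : 0 <= s <= tau by apply/andP; split; lra.
    have sI' : s \in `[0, tau + 1] by rewrite in_itv /=; apply/andP; split; lra.
    have I01rhs : {ae m01, forall x, stepL (rhs_fin eps Gamma H w (thN s)) x =
        rhs_cont Gamma H eps (step_field w) (step_field (thN s)) x}.
      apply/ae_mu01P; apply: aeW => x /(cell_cover N0)[i ci].
      by rewrite stepLE (step_field_cell N0 _ ci) (rhs_cont_step N0 _ _ _ _ _ ci).
    apply: ess_norm_le; apply: filterS3 I01rhs (rhs_lip sI) (seqn sI') => x /= -> hx ->.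
    apply: le_trans hx _; rewrite lerD2r ler_wpM2l // eE eE' //.
    by rewrite ps.
Qed.

End FiniteDynamics.

(** * Averages of bounded Lipschitz kernels *)

Section Kernels.
Variable R : realType.
Local Notation mu := (@lebesgue_measure R).
Local Notation m01 := (mu01 R).
Local Notation I01 := (`[0%R, 1%R]%classic : set R).

Lemma leb01 : mu I01 = 1%E.
Proof. by rewrite lebesgue_measure_itv /= lte_fin ltr01 oppr0 adde0. Qed.

(** A class of kernels that is closed under products and contains Gamma(b - a),
    H and its first partial derivatives. *)
Definition bdlip (k : R -> R -> R) (B L : R) : Prop :=
  [/\ 0 <= B, 0 <= L, forall a b, `|k a b| <= B &
      forall a a' b b', `|k a b - k a' b'| <= L * (`|a - a'| + `|b - b'|)].

Lemma bdlipM k1 k2 B1 L1 B2 L2 : bdlip k1 B1 L1 -> bdlip k2 B2 L2 ->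
  bdlip (fun a b => k1 a b * k2 a b) (B1 * B2) (B1 * L2 + B2 * L1).
Proof.
move=> [B10 L10 b1 l1] [B20 L20 b2 l2]; split.
- exact: mulr_ge0.
- by rewrite addr_ge0 // mulr_ge0.
- by move=> a b; rewrite normrM ler_pM.
- move=> a a' b b'.
  rewrite (_ : _ - _ = k1 a b * (k2 a b - k2 a' b') + k2 a' b' * (k1 a b - k1 a' b')).
    2: by ring.
  apply: le_trans (ler_normD _ _) _; rewrite !normrM mulrDl -!mulrA.
  by apply: lerD; apply: ler_pM.
Qed.

Lemma lipschitz_of_derivative (f : R -> R) B :
  (forall x, derivable f x 1) -> (forall x, `|derive1 f x| <= B) ->
  forall x y, `|f x - f y| <= B * `|x - y|.
Proof.
move=> df dB; have B0 : 0 <= B by apply: le_trans (dB 0).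
move=> x y; wlog : x y / y <= x.
  move=> W; case: (leP y x) => [|/ltW]; first exact: W.
  by rewrite distrC (distrC x); exact: W.
move=> yx; have fc : {within `[y, x], continuous f}.
  by apply: derivable_within_continuous => t _.
have [t _|c _ ->] := MVT_segment (df := derive1 f) yx _ fc.
  by rewrite derive1E; apply: DeriveDef.
by rewrite normrM ler_wpM2r.
Qed.

Lemma bounded_funP (T : Type) (f : T -> R) : bounded_fun f ->
  exists2 B, 0 <= B & forall x, `|f x| <= B.
Proof.
move=> [M [_ HM]]; exists (`|M| + 1); first by rewrite addr_ge0.
by move=> x; apply: HM => //; rewrite ltr_pwDr // ler_norm.
Qed.

Lemma bdlip_Cb2 H : Cb2 1 H -> exists B L, bdlip H B L.
Proof.
move=> [_ /bounded_funP[B B0 HB] [d1 d2 [_ /bounded_funP[B1 B10 HB1] _]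
   [_ /bounded_funP[B2 B20 HB2] _]]].
exists B, (B1 + B2); split => //; first exact: addr_ge0.
  by move=> a b; exact: (HB (a, b)).
move=> a a' b b'.
have h1 : `|H a b - H a' b| <= B1 * `|a - a'|.
  apply: (@lipschitz_of_derivative (fun u => H u b)) => // u.
  exact: (HB1 (u, b)).
have h2 : `|H a' b - H a' b'| <= B2 * `|b - b'|.
  apply: (@lipschitz_of_derivative (fun u => H a' u)) => // u.
  exact: (HB2 (a', u)).
rewrite -(subrK (H a' b) (H a b)) -addrA.
apply: le_trans (ler_normD _ _) _; apply: le_trans (lerD h1 h2) _.
rewrite mulrDl; apply: lerD; apply: ler_wpM2l => //; first by rewrite lerDl.
by rewrite lerDr.
Qed.

Lemma bdlip_diff G : Cb 1 G -> exists B L, bdlip (fun a b => G (b - a)) B L.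
Proof.
move=> [_ /bounded_funP[B B0 HB] [d [_ /bounded_funP[L L0 HL] _]]].
exists B, L; split => //.
move=> a a' b b'; apply: le_trans (lipschitz_of_derivative d HL _ _) _.
rewrite ler_wpM2l // (_ : b - a - (b' - a') = (b - b') - (a - a')); last by ring.
by rewrite [leRHS]addrC; exact: ler_normB.
Qed.

Lemma measurable_bdlip k B L a : bdlip k B L ->
  measurable_fun setT (k a).
Proof.
move=> [_ L0 _ l]; apply: continuous_measurable_fun => b.
apply/cvgrPdist_le => e e0.
have d0 : 0 < e / (L + 1) by rewrite divr_gt0 // ltr_pwDr.
apply: filterS (@nbhsx_ballx _ _ b _ d0) => b'; rewrite /ball /= => bb.
apply: le_trans (l _ _ _ _) _; rewrite subrr normr0 add0r.
have := ler_wpM2l L0 (ltW bb) => h; apply: le_trans h _.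
by rewrite mulrCA ger_pMr // ler_pdivrMr ?mul1r ?lerDl // ltr_pwDr.
Qed.

(** The operators of the equation are combinations of such averages, with
    weight eta equal to 1, to the frequency field, or to K[th]. *)
Definition kavg (k : R -> R -> R) (th eta : R -> R) (a : R) : R :=
  \int[mu]_(y in I01) (k a (th y) * eta y).

Section KernelAverage.
Variables (k : R -> R -> R) (B L : R) (kP : bdlip k B L).

Lemma kavg_integrable (th : Linf R) (eta : R -> R) M a :
  @measurable_fun _ _ (measurableTypeR R) R setT eta ->
  {ae m01, forall y, `|eta y| <= M} ->
  mu.-integrable I01 (EFin \o (fun y => k a (th y) * eta y)).
Proof.
move=> meta /ae_mu01P etaM; have [B0 L0 b l] := kP.
apply: (@integrable_ae_bounded _ _ _ _ _ _ (B * M)) => //.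
- exact: itv_lty.
- apply: measurable_funTS; apply: measurable_funM => //.
  apply: (measurableT_comp (measurable_bdlip a kP)).
  exact: Linf_measurable.
- by apply: filterS etaM => y h yI; rewrite normrM ler_pM // h.
Qed.

Lemma kavg_bound (th : Linf R) (eta : R -> R) M a :
  @measurable_fun _ _ (measurableTypeR R) R setT eta -> 0 <= M ->
  {ae m01, forall y, `|eta y| <= M} -> `|kavg k th eta a| <= B * M.
Proof.
move=> meta M0 etaM; have [B0 L0 b l] := kP.
have I := kavg_integrable th a meta etaM.
have mI : @measurable _ (measurableTypeR R) I01 by exact: measurable_itv.
apply: le_trans (le_norm_Rintegral_ae mI (itv_lty 0 1) (mulr_ge0 B0 M0) _ _) _.
- by case/integrableP: I => /measurable_EFinP.
- move/ae_mu01P: etaM; apply: filterS => y h yI.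
  by rewrite normrM ler_pM // h.
- by rewrite (_ : fine _ = 1) ?mulr1 //; exact: (congr1 fine leb01).
Qed.

(** The integrands differ by k eta - k' eta' = k (eta - eta') + (k - k') eta',
    where k' is k at the phases th2. *)
Lemma kavg_diff (th1 th2 : Linf R) (eta1 eta2 : R -> R) M1 M2 d de a1 a2 :
  @measurable_fun _ _ (measurableTypeR R) R setT eta1 ->
  @measurable_fun _ _ (measurableTypeR R) R setT eta2 ->
  {ae m01, forall y, `|eta1 y| <= M1} -> {ae m01, forall y, `|eta2 y| <= M2} ->
  0 <= M2 -> 0 <= d -> 0 <= de ->
  {ae m01, forall y, `|eta1 y - eta2 y| <= de} ->
  {ae m01, forall y, `|th1 y - th2 y| <= d} -> `|a1 - a2| <= d ->
  `|kavg k th1 eta1 a1 - kavg k th2 eta2 a2| <= B * de + L * (2 * d) * M2.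
Proof.
move=> me1 me2 eM1 eM2 M20 d0 de0 /ae_mu01P ede /ae_mu01P thd ad.
have [B0 L0 b l] := kP.
have mI : @measurable _ (measurableTypeR R) I01 by exact: measurable_itv.
have I1 := kavg_integrable th1 a1 me1 eM1.
have I2 := kavg_integrable th2 a2 me2 eM2.
rewrite /kavg -RintegralB //.
have c0 : 0 <= B * de + L * (2 * d) * M2 by rewrite addr_ge0 ?mulr_ge0.
apply: le_trans (le_norm_Rintegral_ae mI (itv_lty 0 1) c0 _ _) _.
- apply: measurable_funB; first by case/integrableP: I1 => /measurable_EFinP.
  by case/integrableP: I2 => /measurable_EFinP.
- move/ae_mu01P: eM2 => eM2; apply: filterS3 ede thd eM2 => y h1 h2 h3 yI.
  rewrite (_ : _ - _ = k a1 (th1 y) * (eta1 y - eta2 y) +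
    (k a1 (th1 y) - k a2 (th2 y)) * eta2 y); last by ring.
  apply: le_trans (ler_normD _ _) _; rewrite !normrM; apply: lerD.
    by apply: ler_pM => //; exact: h1.
  apply: ler_pM => //; last exact: h3.
  apply: le_trans (l _ _ _ _) _; apply: ler_wpM2l => //.
  by rewrite mulr_natl mulr2n; apply: lerD => //; exact: h2.
- by rewrite (_ : fine _ = 1) ?mulr1 //; exact: (congr1 fine leb01).
Qed.

End KernelAverage.
End Kernels.

(** * Lipschitz continuity of the truncated field *)

Section KernelField.
Variable R : realType.
Local Notation mu := (@lebesgue_measure R).
Local Notation m01 := (mu01 R).
Local Notation I01 := (`[0%R, 1%R]%classic : set R).

Let one : R -> R := fun=> 1.

Variables (k0 k1 k2 : R -> R -> R) (B0 L0 B1 L1 B2 L2 : R).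
Hypothesis k0P : bdlip k0 B0 L0.
Hypothesis k1P : bdlip k1 B1 L1.
Hypothesis k2P : bdlip k2 B2 L2.

Let mone : @measurable_fun _ _ (measurableTypeR R) R setT one.
Proof. exact: measurable_cst. Qed.

Let one_le : {ae m01, forall y, `|one y| <= 1}.
Proof. by apply: aeW => y; rewrite normr1. Qed.

(** The right-hand side of the equation for abstract kernels: k0 stands for
    H Gamma, k1 and k2 for Gamma times the partial derivatives of H. *)
Definition kernel_rhs (eps : R) (om th : R -> R) (x : R) : R :=
  om x + kavg k0 th one (th x)
  + eps * - (om x * kavg k1 th one (th x) + kavg k2 th om (th x))
  + eps * (- (kavg k1 th one (th x) * kavg k0 th one (th x))
           - kavg k2 th (fun y => kavg k0 th one (th y)) (th x)).

(** The average is Lipschitz in the phase, hence Borel; it is a weight in the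
    second double integral of [T_op]. *)
Lemma measurable_kavg (th : Linf R) :
  @measurable_fun _ _ (measurableTypeR R) R setT (fun y => kavg k0 th one (th y)).
Proof.
apply: (@measurableT_comp _ _ _ _ _ _ (kavg k0 th one)); last exact: Linf_measurable.
apply: continuous_measurable_fun => a; apply/cvgrPdist_le => e e0.
have [_ L00 _ _] := k0P.
have d0 : 0 < e / (2 * L0 + 1) by rewrite divr_gt0 // ltr_wpDl // mulr_ge0.
apply: filterS (@nbhsx_ballx _ _ a _ d0) => b; rewrite /ball /= => ab.
have := @kavg_diff _ k0 B0 L0 k0P th th one one 1 1 `|a - b| 0 a b mone mone
  one_le one_le ler01 (normr_ge0 _) (lexx _).
move=> /(_ _ _ (lexx _)) h; apply: le_trans (h _ _) _.
- by apply: aeW => y; rewrite subrr normr0.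
- by apply: aeW => y; rewrite subrr normr0.
- rewrite mulr0 add0r mulr1 mulrA (mulrC L0).
  have := ler_wpM2l (_ : 0 <= 2 * L0) (ltW ab) => /(_ _) h2.
  apply: le_trans (h2 _) _; first exact: mulr_ge0.
  by rewrite mulrCA ger_pMr // ler_pdivrMr ?mul1r ?lerDl // ltr_wpDl // mulr_ge0.
Qed.

(** A telescoping of each product, for instance
    om1 a1 - om2 a2 = a1 (om1 - om2) + om2 (a1 - a2). *)
Lemma kernel_rhs_diff (eps M : R) (th1 th2 om1 om2 : Linf R) :
  0 < eps -> ess_norm om2 <= M ->
  {ae m01, forall x,
    `|kernel_rhs eps om1 th1 x - kernel_rhs eps om2 th2 x| <=
    (2 * L0 + eps * (2 * M * (L1 + L2)) +
      eps * (2 * B1 * L0 + 2 * B0 * L1 + 2 * B2 * L0 + 2 * B0 * L2)) *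
      ess_norm (th1 \- th2) +
    (1 + eps * (B1 + B2)) * ess_norm (om1 \- om2)}.
Proof.
move=> eps0 omM.
have M0 : 0 <= M by apply: le_trans omM; exact: ess_norm_ge0.
have [B00 L00 _ _] := k0P; have [B10 L10 _ _] := k1P; have [B20 L20 _ _] := k2P.
set d := ess_norm (th1 \- th2); set de := ess_norm (om1 \- om2).
have d0 : 0 <= d by exact: ess_norm_ge0.
have de0 : 0 <= de by exact: ess_norm_ge0.
have thd := ess_norm_ae (LinfB_fin th1 th2).
have omd := ess_norm_ae (LinfB_fin om1 om2).
have om2b : {ae m01, forall x, `|om2 x| <= M}.
  by apply: filterS (ess_norm_ae (Linf_fin om2)) => x h; exact: le_trans h omM.
have one0 : {ae m01, forall y, `|one y - one y| <= 0}.
  by apply: aeW => y; rewrite subrr normr0.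
have dK a1 a2 : `|a1 - a2| <= d ->
    `|kavg k0 th1 one a1 - kavg k0 th2 one a2| <= 2 * L0 * d.
  move=> h; apply: le_trans (kavg_diff k0P mone mone one_le one_le ler01 d0
    (lexx 0) one0 thd h) _.
  by rewrite mulr0 add0r mulr1 mulrA (mulrC L0).
have d1 a1 a2 : `|a1 - a2| <= d ->
    `|kavg k1 th1 one a1 - kavg k1 th2 one a2| <= 2 * L1 * d.
  move=> h; apply: le_trans (kavg_diff k1P mone mone one_le one_le ler01 d0
    (lexx 0) one0 thd h) _.
  by rewrite mulr0 add0r mulr1 mulrA (mulrC L1).
have bK (th : Linf R) a : `|kavg k0 th one a| <= B0.
  by have := kavg_bound k0P th a mone ler01 one_le; rewrite mulr1.
have b1 (th : Linf R) a : `|kavg k1 th one a| <= B1.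
  by have := kavg_bound k1P th a mone ler01 one_le; rewrite mulr1.
have dKae : {ae m01, forall y, `|kavg k0 th1 one (th1 y) - kavg k0 th2 one (th2 y)| <=
    2 * L0 * d}.
  by apply: filterS thd => y; exact: dK.
have [thd' omd' om2b'] := And3 thd omd om2b.
apply: filterS3 thd' omd' om2b' => x /= thx omx om2x.
rewrite -/d in thx; rewrite -/de in omx.
have hK := dK _ _ thx; have h1 := d1 _ _ thx.
have h2 := kavg_diff k2P (Linf_measurable om1) (Linf_measurable om2)
  (ess_norm_ae (Linf_fin om1)) om2b M0 d0 de0 omd thd thx.
have bKae (th : Linf R) : {ae m01, forall y, `|kavg k0 th one (th y)| <= B0}.
  by apply: aeW => y; exact: bK.
have h3 := kavg_diff k2P (measurable_kavg th1) (measurable_kavg th2)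
  (bKae th1) (bKae th2) B00 d0 (mulr_ge0 (mulr_ge0 (ler0n R 2) L00) d0) dKae thd thx.
have hKb := bK th2 (th2 x); have h1b := b1 th1 (th1 x).
rewrite /kernel_rhs.
move: hK h1 h2 h3 hKb h1b omx om2x.
move: (kavg k0 th1 one (th1 x)) (kavg k0 th2 one (th2 x)) => c1 c2.
move: (kavg k1 th1 one (th1 x)) (kavg k1 th2 one (th2 x)) => a1 a2.
move: (kavg k2 th1 om1 (th1 x)) (kavg k2 th2 om2 (th2 x)) => p1 p2.
move: (kavg k2 th1 _ (th1 x)) (kavg k2 th2 _ (th2 x)) => q1 q2.
move: (om1 x) (om2 x) => o1 o2 hK h1 h2 h3 hKb h1b ho ho2.
have hP : `|o1 * a1 - o2 * a2| <= B1 * de + M * (2 * L1 * d).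
  have -> : o1 * a1 - o2 * a2 = a1 * (o1 - o2) + o2 * (a1 - a2) by ring.
  apply: le_trans (ler_normD _ _) _; rewrite !normrM.
  by apply: lerD; apply: ler_pM.
have hT : `|a1 * c1 - a2 * c2| <= B1 * (2 * L0 * d) + B0 * (2 * L1 * d).
  have -> : a1 * c1 - a2 * c2 = a1 * (c1 - c2) + c2 * (a1 - a2) by ring.
  apply: le_trans (ler_normD _ _) _; rewrite !normrM.
  by apply: lerD; apply: ler_pM.
have -> : o1 + c1 + eps * - (o1 * a1 + p1) + eps * (- (a1 * c1) - q1) -
    (o2 + c2 + eps * - (o2 * a2 + p2) + eps * (- (a2 * c2) - q2)) =
    (o1 - o2) + (c1 - c2) +
    eps * - ((o1 * a1 - o2 * a2) + (p1 - p2)) +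
    eps * - ((a1 * c1 - a2 * c2) + (q1 - q2)) by ring.
have tri (u v a b : R) : `|u| <= a -> `|v| <= b -> `|u + v| <= a + b.
  by move=> hu hv; apply: le_trans (ler_normD _ _) _; exact: lerD.
have trie (u a : R) : `|u| <= a -> `|eps * - u| <= eps * a.
  by move=> hu; rewrite normrM normrN gtr0_norm // ler_pM2l.
apply: le_trans (tri _ _ _ _ (tri _ _ _ _ (tri _ _ _ _ ho hK)
  (trie _ _ (tri _ _ _ _ hP h2))) (trie _ _ (tri _ _ _ _ hT h3))) _.
by rewrite le_eqVlt; apply/orP; left; apply/eqP; ring.
Qed.

End KernelField.

Section OperatorsAsAverages.
Variables (R : realType) (Gamma : R -> R) (H : R -> R -> R).
Local Notation mu := (@lebesgue_measure R).
Local Notation m01 := (mu01 R).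
Local Notation I01 := (`[0%R, 1%R]%classic : set R).

Let k0 a b := H a b * Gamma (b - a).
Let k1 a b := Gamma (b - a) * pd1 H a b.
Let k2 a b := Gamma (b - a) * pd2 H a b.
Let one : R -> R := fun=> 1.

Variables (B0 L0 B1 L1 B2 L2 : R).
Hypothesis k0P : bdlip k0 B0 L0.
Hypothesis k1P : bdlip k1 B1 L1.
Hypothesis k2P : bdlip k2 B2 L2.

Let mI : @measurable _ (measurableTypeR R) I01. Proof. exact: measurable_itv. Qed.

Let mone : @measurable_fun _ _ (measurableTypeR R) R setT one.
Proof. exact: measurable_cst. Qed.

Let one_le : {ae m01, forall y, `|one y| <= 1}.
Proof. by apply: aeW => y; rewrite normr1. Qed.

Lemma K_op_kavg (th : R -> R) x : K_op Gamma H th x = kavg k0 th one (th x).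
Proof. by rewrite /K_op /kavg; apply: eq_Rintegral => y _; rewrite mulr1. Qed.

Lemma P_op_kavg (th om : Linf R) x : P_op Gamma H th om x =
  - (om x * kavg k1 th one (th x) + kavg k2 th om (th x)).
Proof.
have I1 := kavg_integrable k1P th (th x) mone one_le.
have I2 := kavg_integrable k2P th (th x) (Linf_measurable om) (ess_norm_ae (Linf_fin om)).
rewrite /P_op /kavg -RintegralZl // -RintegralD //; last first.
  by have := integrableZl mI (om x) I1; apply: eq_integrable.
congr (- _); apply: eq_Rintegral => y _; rewrite /k1 /k2 /one; ring.
Qed.

(** In the first double integral the variables y and z separate; in the second
    one the integral over z is K[th](y). *)
Lemma T_op_kavg (th : Linf R) x : T_op Gamma H th x =
  - (kavg k1 th one (th x) * kavg k0 th one (th x))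
  - kavg k2 th (fun y => kavg k0 th one (th y)) (th x).
Proof.
have I0 a := kavg_integrable k0P th a mone one_le.
have I1 := kavg_integrable k1P th (th x) mone one_le.
rewrite /T_op; congr (- _ - _).
  rewrite /kavg -RintegralZr //; apply: eq_Rintegral => y _.
  rewrite mulr1 -RintegralZl //; apply: eq_Rintegral => z _.
  by rewrite /k1 /k0 /one; ring.
rewrite /kavg; apply: eq_Rintegral => y _; rewrite -RintegralZl //.
by apply: eq_Rintegral => z _; rewrite /k2 /k0 /one; ring.
Qed.

Lemma rhs_cont_kernel_rhs eps (om th : Linf R) x :
  rhs_cont Gamma H eps om th x = kernel_rhs k0 k1 k2 eps om th x.
Proof. by rewrite /rhs_cont K_op_kavg P_op_kavg T_op_kavg. Qed.

End OperatorsAsAverages.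

(** The bound M is on om2 alone, thanks to the way in which products are split
    in [kernel_rhs_diff].  With the limit frequency as om2, the constants L and
    B do not depend on the step frequencies. *)
Lemma rhs_cont_lipschitz (R : realType) (Gamma : R -> R) (H : R -> R -> R) (eps M : R) :
  0 < eps -> 0 <= M -> Cb 1 Gamma -> Cb2 2 H ->
  exists L B : R, [/\ 0 <= L, 0 <= B &
    forall th1 th2 om1 om2 : Linf R, ess_norm om2 <= M ->
    {ae mu01 R, forall x,
      `|rhs_cont Gamma H eps om1 th1 x - rhs_cont Gamma H eps om2 th2 x| <=
      L * ess_norm (th1 \- th2) + B * ess_norm (om1 \- om2)}].
Proof.
move=> eps0 M0 CG [cH bH [dH1 dH2 CH1 CH2]].
have [BG [LG GP]] := bdlip_diff CG.
have [BH [LH HP]] : exists B L, bdlip H B L.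
  have C0 (K : R -> R -> R) : Cb2 1 K -> Cb2 0 K by case=> cK bK _; split.
  apply: bdlip_Cb2.
  exact: (And3 cH bH (And4 dH1 dH2 (C0 _ CH1) (C0 _ CH2))).
have [B1 [L1 P1]] := bdlip_Cb2 CH1.
have [B2 [L2 P2]] := bdlip_Cb2 CH2.
have k0P := bdlipM HP GP; have k1P := bdlipM GP P1; have k2P := bdlipM GP P2.
have [a1 a2 _ _] := k0P; have [a3 a4 _ _] := k1P; have [a5 a6 _ _] := k2P.
eexists; eexists; split; last first.
- move=> th1 th2 om1 om2 omM.
  have D := kernel_rhs_diff k0P k1P k2P th1 th2 om1 eps0 omM.
  apply: filterS D => x; rewrite -!(rhs_cont_kernel_rhs k0P k1P k2P) => D.
  exact: D.
- have e0 := ltW eps0.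
  by apply: addr_ge0 => //; apply: mulr_ge0 => //; exact: addr_ge0.
- have e0 := ltW eps0; have two0 : 0 <= 2 :> R by [].
  by repeat first [assumption | apply: addr_ge0 | apply: mulr_ge0].
Qed.

(** * Error bounds *)

Section ErrorBounds.
Variable R : realType.
Local Notation m01 := (mu01 R).

Lemma linf_normEfine (f g : Linf R) : linf_norm (f \- g) = (ess_norm (f \- g))%:E.
Proof. by rewrite /ess_norm fineK //; exact: LinfB_fin. Qed.

Lemma data_errorE (om th0 : Linf R) N (w th0N : 'I_N -> R) :
  data_error om th0 w th0N =
  (ess_norm (step_field th0N \- th0) + ess_norm (step_field w \- om))%:E.
Proof. by rewrite /data_error -!stepL_fun !linf_normEfine EFinD. Qed.

(** The initial and the frequency error are both at most the data error, which
    gives the factor 1 + B. *)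
Lemma sup_error_le (eps : R) Gamma H (om th0 : Linf R) N (w th0N : 'I_N -> R)
    (thN : R -> 'I_N -> R) (th : R -> Linf R) (tau L B : R) :
  (0 < N)%N -> 0 < tau -> 0 <= L -> 0 <= B -> Cb 1 Gamma -> Cb2 2 H ->
  finite_solution eps Gamma H w th0N thN ->
  strong_solution eps Gamma H om th0 (tau + 1) th ->
  (forall t, 0 <= t <= tau -> {ae m01, forall x,
    `|rhs_cont Gamma H eps (stepL w) (stepL (thN t)) x -
      rhs_cont Gamma H eps om (th t) x| <=
    L * ess_norm (stepL (thN t) \- th t) + B * ess_norm (stepL w \- om)}) ->
  (sup_error tau th thN <=
    (expR ((L + 1) * tau) * (1 + B))%:E * data_error om th0 w th0N)%E.
Proof.
move=> N0 tau0 L0 B0 [Gc _ _] [Hc _ [_ _ [H1c _ _] [H2c _ _]]] fsol csol lip.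
rewrite /sup_error; apply: ge_ereal_sup => _ /= [t tI <-].
move: tI; rewrite /= in_itv /= => tI.
rewrite data_errorE -stepL_fun linf_normEfine -EFinM lee_fin stepL_fun.
have lip' : forall t, 0 <= t <= tau -> {ae m01, forall x,
    `|rhs_cont Gamma H eps (step_field w) (step_field (thN t)) x -
      rhs_cont Gamma H eps om (th t) x| <=
    L * ess_norm (step_field (thN t) \- th t) + B * ess_norm (step_field w \- om)}.
  by move=> s sI; have := lip s sI; rewrite !stepL_fun.
apply: le_trans (stability_estimate Gc Hc H1c H2c N0 fsol tau0 L0 B0 csol lip' tI) _.
rewrite -mulrA ler_wpM2l ?expR_ge0 //.
have := ess_norm_ge0 (step_field th0N \- th0); have := ess_norm_ge0 (step_field w \- om).
move: (ess_norm (step_field th0N \- th0)) (ess_norm (step_field w \- om)) => a b b0 a0.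
rewrite -subr_ge0 (_ : _ - _ = b + B * a); last by ring.
by rewrite addr_ge0 // mulr_ge0.
Qed.

(** The three given bounds add up to Lambda and B.  These may be negative a
    priori, whereas the stability estimate asks for nonnegative constants. *)
Lemma rhs_cont_lip_of_constants (eps : R) Gamma H M (CK CPth CPom CT : R)
    (th1 th2 om1 om2 : Linf R) :
  0 < eps -> lipschitz_constants Gamma H M CK CPth CPom CT ->
  (linf_norm om1 <= M)%E -> (linf_norm om2 <= M)%E ->
  {ae m01, forall x,
    `|rhs_cont Gamma H eps om1 th1 x - rhs_cont Gamma H eps om2 th2 x| <=
    `|Lambda eps CK CPth CT| * ess_norm (th1 \- th2) +
    `|Bconst eps CPom| * ess_norm (om1 \- om2)}.
Proof.
move=> eps0 lip M1 M2; have [hK hP hT] := lip th1 th2 om1 om2 M1 M2.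
move: hK hP hT; rewrite !linf_normEfine -!EFinM -EFinD.
set d := ess_norm _; set de := ess_norm _.
have d0 : 0 <= d by exact: ess_norm_ge0.
have de0 : 0 <= de by exact: ess_norm_ge0.
move=> /linf_normP hK /linf_normP hP /linf_normP hT.
have hom := ess_norm_ae (LinfB_fin om1 om2).
have hKP : {ae m01, forall x,
    `|K_op Gamma H th1 x - K_op Gamma H th2 x| <= CK * d /\
    `|P_op Gamma H th1 om1 x - P_op Gamma H th2 om2 x| <= CPth * d + CPom * de}.
  by apply: filterS2 hK hP.
apply: filterS3 hKP hT hom => x /= [{}hK {}hP] {}hT {}hom.
rewrite -/de in hom.
have tri (u v a b : R) : `|u| <= a -> `|v| <= b -> `|u + v| <= a + b.
  by move=> hu hv; apply: le_trans (ler_normD _ _) _; exact: lerD.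
have trie (u a : R) : `|u| <= a -> `|eps * u| <= eps * a.
  by move=> hu; rewrite normrM gtr0_norm // ler_pM2l.
rewrite /rhs_cont.
have split_diff (o o' k k' p p' t t' : R) :
    o + k + eps * p + eps * t - (o' + k' + eps * p' + eps * t') =
    (o - o') + (k - k') + eps * (p - p') + eps * (t - t') by ring.
rewrite split_diff.
apply: le_trans (tri _ _ _ _ (tri _ _ _ _ (tri _ _ _ _ hom hK) (trie _ _ hP))
  (trie _ _ hT)) _.
apply: (@le_trans _ _ (Lambda eps CK CPth CT * d + Bconst eps CPom * de)).
  by rewrite /Lambda /Bconst le_eqVlt; apply/orP; left; apply/eqP; ring.
by apply: lerD; apply: ler_wpM2r => //; exact: ler_norm.
Qed.

End ErrorBounds.

(** * Convergence *)

Theorem theorem3p7 (R : realType) :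
  exists Cred : R -> R -> R -> R,
  forall (eps : R) (Gamma : R -> R) (H : R -> R -> R) (om th0 : Linf R)
    (w th0N : forall N : nat, 'I_N -> R)
    (thN : forall N : nat, R -> 'I_N -> R) (th : R -> Linf R),
    0 < eps ->
    Cb 1 Gamma -> periodic Gamma (2 * pi) ->
    Cb2 2 H ->
    (forall b : R, periodic (fun a : R => H a b) (2 * pi)) ->
    (forall a : R, periodic (fun b : R => H a b) (2 * pi)) ->
    data_error om th0 (w N) (th0N N) @[N --> \oo] --> 0%E ->
    (forall N : nat, (0 < N)%N ->
      finite_solution eps Gamma H (w N) (th0N N) (thN N)) ->
    (forall tau : R, 0 < tau -> strong_solution eps Gamma H om th0 tau th) ->
    (forall tau : R, 0 < tau ->
      sup_error tau th (thN N) @[N --> \oo] --> 0%E) /\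
    (forall CK CPth CPom CT : R,
      lipschitz_constants Gamma H (M_omega om w) CK CPth CPom CT ->
      forall (tau : R) (N : nat), 0 < tau -> (0 < N)%N ->
        (sup_error tau th (thN N) <=
           (Cred tau (Lambda eps CK CPth CT) (Bconst eps CPom))%:E *
           data_error om th0 (w N) (th0N N))%E).
Proof.
exists (fun tau La Bc => expR ((`|La| + 1) * tau) * (1 + `|Bc|)).
move=> eps Gamma H om th0 w th0N thN th eps0 CG _ CH _ _ data0 fsol csol.
split.
- move=> tau tau0.
  have [L [B [L0 B0 lip]]] :=
    rhs_cont_lipschitz eps0 (ess_norm_ge0 om) CG CH.
  pose C := expR ((L + 1) * tau) * (1 + B).
  have C0 : (C%:E * data_error om th0 (w N) (th0N N))%E @[N --> \oo] --> 0%E.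
    by rewrite -[X in _ --> X](mule0 C%:E); apply: cvgeZl.
  apply: (squeeze_cvge _ (cvg_cst 0%E) C0).
  near=> N.
  have N0 : (0 < N)%N by near: N; exact: nbhs_infty_gt.
  apply/andP; split.
    apply: (@le_trans _ _ (linf_norm (step_field (thN N 0) \- th 0))).
      exact: linf_norm_ge0.
    by apply: ereal_sup_ubound; exists 0 => //=; rewrite in_itv /= lexx ltW.
  apply: (sup_error_le N0 tau0 L0 B0 CG CH (fsol N N0) (csol _ (addr_gt0 tau0 ltr01))).
  by move=> t _; exact: lip.
- move=> CK CPth CPom CT lip tau N tau0 N0.
  apply: (sup_error_le N0 tau0 (normr_ge0 _) (normr_ge0 _) CG CH (fsol N N0)
    (csol _ (addr_gt0 tau0 ltr01))).
  move=> t _; apply: (rhs_cont_lip_of_constants _ _ eps0 lip).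
  + rewrite stepL_fun /M_omega le_max; apply/orP; right.
    by apply: ereal_sup_ubound; exists N.
  + by rewrite /M_omega le_max lexx.
Unshelve. all: by end_near. Qed.
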